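(* Let $Y\subseteq\mathbb{R}^2$ be the collection of vertices of any Penrose tiling. Then there is a bijection from $Y$ to a lattice which moves every point by at most a uniformly finite amount; that is, there exist a lattice $L\subseteq\mathbb{R}^2$, a bijection $f:Y\to L$ and a constant $C<\infty$ such that $|f(y)-y|\le C$ for all $y\in Y$.
   Context: A lattice in $\mathbb{R}^2$ is a discrete subgroup of rank $2$. Penrose tilings here are the usual Penrose rhombus tilings of the plane (by thick rhombuses with angles $72^\circ,108^\circ$ and thin rhombuses with angles $36^\circ,144^\circ$, satisfying the Penrose matching rules). An equivalent explicit description is as follows. Let $\varphi=(1+\sqrt5)/2$ and identify $\mathbb{R}^2$ with $\mathbb{C}$. A labelled triangle is a triple $(A,B,C)$ of points of the plane forming a triangle with $|AB|=|AC|$ which is either of type $0$ (angle $36^\circ$ at $A$) or of type $1$ (angle $108^\circ$ at $A$). The substitution $S$ replaces a labelled triangle by smaller labelled triangles subdividing it: - for type $0$, with $P=A+(B-A)/\varphi$, the triangle $(A,B,C)$ is replaced by $(C,P,B)$ (type $0$) and $(P,C,A)$ (type $1$); - for type $1$, with $Q=B+(A-B)/\varphi$ and $R=B+(C-B)/\varphi$, the triangle $(A,B,C)$ is replaced by $(R,C,A)$ (type $1$), $(Q,R,B)$ (type $1$) and $(R,Q,A)$ (type $0$). $S$ is applied to a collection of labelled triangles by applying it to each member, and $S^n$ is its $n$-th iterate. A Penrose tiling (in triangle form) is a collection of labelled triangles, all with legs $|AB|=|AC|$ of one common length, which cover the plane with pairwise disjoint interiors, such that every finite subcollection is the image under a similarity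 of the plane (orientation reversing ones allowed, labels being transported) of a subcollection of $S^n(T)$ for some labelled triangle $T$ and some $n\ge 0$. The rhombus tiling is obtained by erasing all the sides $BC$, so that triangles are glued in pairs along these sides into thick rhombuses (type $1$) and thin rhombuses (type $0$). The vertices of the tiling are the vertices of the rhombuses; equivalently, all points $A,B,C$ of the labelled triangles. *)

(* Defs.v *)
From mathcomp Require Export all_boot all_order all_algebra.
From mathcomp Require Export all_classical all_reals all_analysis.
Export numFieldNormedType.Exports.

Set Implicit Arguments.
Unset Strict Implicit.
Unset Printing Implicit Defensive.

Import Order.TTheory GRing.Theory Num.Theory.

Local Open Scope classical_set_scope.
Local Open Scope ring_scope.

(* The library norm on 'rV[R]_2 is the sup norm (it is used below only through
   the topology it induces); lengths and angles are Euclidean. *)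
Definition dot (R : realType) (u v : 'rV[R]_2) : R := (u *m v^T) 0 0.

Definition enorm (R : realType) (u : 'rV[R]_2) : R := Num.sqrt (dot u u).

Definition dist (R : realType) (x y : 'rV[R]_2) : R := enorm (x - y).

Definition angle (R : realType) (u v : 'rV[R]_2) : R :=
  acos (dot u v / (enorm u * enorm v)).

Definition similarity (R : realType) (g : 'rV[R]_2 -> 'rV[R]_2) : Prop :=
  exists2 r : R, 0 < r & forall x y, dist (g x) (g y) = r * dist x y.

Definition zindep (V : zmodType) (m : nat) (s : 'I_m -> V) : Prop :=
  forall c : 'I_m -> int, \sum_(i < m) s i *~ c i = 0 -> forall i, c i = 0.

Definition zrank (V : zmodType) (L : set V) (n : nat) : Prop :=
  (exists2 s : 'I_n -> V, forall i, L (s i) & zindep s) /\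
  (forall (m : nat) (s : 'I_m -> V),
     (forall i, L (s i)) -> zindep s -> (m <= n)%N).

Definition lattice (R : realType) (L : set 'rV[R]_2) : Prop :=
  [/\ zmod_closed [in L], L `<=` isolated L & zrank L 2].

Definition golden (R : realType) : R := (1 + Num.sqrt 5) / 2.

(* A triangle is the ordered triple (A, B, C), with A the apex; its type is
   determined by the angle at A. *)
Definition triangle (R : realType) : Type :=
  ('rV[R]_2 * 'rV[R]_2 * 'rV[R]_2)%type.

Definition isosceles (R : realType) (t : triangle R) : Prop :=
  let: (A, B, C) := t in
  row_free (col_mx (B - A) (C - A)) /\ dist A B = dist A C.

Definition apex_angle (R : realType) (t : triangle R) : R :=
  let: (A, B, C) := t in angle (B - A) (C - A).

Definition type0 (R : realType) (t : triangle R) : Prop :=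
  isosceles t /\ apex_angle t = pi / 5.

Definition type1 (R : realType) (t : triangle R) : Prop :=
  isosceles t /\ apex_angle t = 3 * pi / 5.

Definition labelled (R : realType) (t : triangle R) : Prop :=
  type0 t \/ type1 t.

Definition children0 (R : realType) (t : triangle R) : set (triangle R) :=
  let: (A, B, C) := t in
  let P := A + (golden R)^-1 *: (B - A) in
  [set (C, P, B); (P, C, A)].

Definition children1 (R : realType) (t : triangle R) : set (triangle R) :=
  let: (A, B, C) := t in
  let Q := B + (golden R)^-1 *: (A - B) in
  let R' := B + (golden R)^-1 *: (C - B) in
  [set (R', C, A); (Q, R', B); (R', Q, A)].

Definition subst (R : realType) (X : set (triangle R)) : set (triangle R) :=
  [set u | exists2 t, X t &
    (type0 t /\ children0 t u) \/ (type1 t /\ children1 t u)].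

Definition leg (R : realType) (t : triangle R) : R :=
  let: (A, B, C) := t in dist A B.

Definition region (R : realType) (t : triangle R) : set 'rV[R]_2 :=
  let: (A, B, C) := t in
  [set x | exists a b c : R, [/\ 0 <= a, 0 <= b, 0 <= c, a + b + c = 1 &
    x = a *: A + b *: B + c *: C]].

Definition map_triangle (R : realType) (g : 'rV[R]_2 -> 'rV[R]_2)
    (t : triangle R) : triangle R :=
  let: (A, B, C) := t in (g A, g B, g C).

Definition penrose_tiling (R : realType) (P : set (triangle R)) : Prop :=
  [/\ P `<=` @labelled R,
      exists l : R, forall t, P t -> leg t = l,
      \bigcup_(t in P) region t = setT,
      trivIset P (fun t => interior (region t)) &
      forall F : set (triangle R), finite_set F -> F `<=` P ->
        exists (g : 'rV[R]_2 -> 'rV[R]_2) (T : triangle R) (n : nat)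
               (G : set (triangle R)),
          [/\ similarity g, labelled T, G `<=` iter n (@subst R) [set T] &
              F = map_triangle g @` G]].

Definition vertices (R : realType) (P : set (triangle R)) : set 'rV[R]_2 :=
  [set x | exists2 t, P t & let: (A, B, C) := t in [\/ x = A, x = B | x = C]].

(* Main.v *)
Require Import Defs.
From mathcomp Require Import measurable_realfun ring lra zify.

Set Implicit Arguments.
Unset Strict Implicit.
Unset Printing Implicit Defensive.

Import Order.TTheory GRing.Theory Num.Theory.

Local Open Scope classical_set_scope.
Local Open Scope ring_scope.

(** Mass is transported from the vertices to the tiles, from the tiles to the
    plane, and from the plane to the lattice, always over a bounded distance.

    Vertices to tiles.  Give each corner of a tile the fraction of a full turn
    measured by its angle.  A vertex of the tiling receives a full turn in all
    and a tile always gives half a turn, so there are half as many vertices as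
    tiles, locally ([vertices_le_tiles], [tiles_le_vertices]).  That the angles
    at a vertex add up to a full turn is read off the substitution: a point
    interior to a supertile becomes a vertex when it splits an edge shared by
    two siblings, each of which contributes half a turn, and later
    substitutions preserve the angle ([supertile_angle_sum]).

    Tiles to area.  The substitution matrix has eigenvalues [phi ^+ 2] and
    [phi ^- 2].  Hence a supertile of level [n] contains a number of tiles equal
    to its suitably normalised area up to an error of order [phi ^- (2 * n)].
    Cut a finite set [F] of tiles into maximal supertiles: the discrepancy
    between its number of tiles and its area is at most the sum over the levels
    of [phi ^- (2 * n)] times the number of tiles outside [F] that touch [F]
    ([supertile_discrepancy]).  The geometric series is so small that the mass
    of these neighbouring tiles absorbs the whole discrepancy, in both
    directions ([tiling_weight_count]).  The hierarchy of supertiles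
    comes from the definition of the tiling: any finite patch is part of a
    supertile ([finite_patch]).

    Area to lattice.  Choose a square lattice whose cells have the area of one
    vertex.  Since Lebesgue measure is additive, the cells meeting a set of
    tiles are at least as numerous as the area of these tiles requires, and
    conversely ([tiles_in_cells], [cells_in_tiles]).

    Composing the three comparisons gives Hall's condition in both directions
    for the relation of being at distance at most a constant
    ([hall_vertices], [hall_grid]).  This relation is locally finite, so the
    marriage theorem yields an injection each way ([hall_matching]), and a
    Cantor-Bernstein argument merges them into a bijection that still moves
    points by a bounded amount ([bernstein_relation]). *)

(** * The golden ratio *)

Section Golden.
Context {R : realType}.
Local Notation phi := (golden R).

Lemma golden_sqr : phi * phi = phi + 1.
Proof.
have h : Num.sqrt 5 * Num.sqrt 5 = 5 :> R by rewrite -expr2 sqr_sqrtr.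
by rewrite /golden; lra.
Qed.

Lemma golden_gt : 8 / 5 < phi.
Proof.
have h : Num.sqrt 5 * Num.sqrt 5 = 5 :> R by rewrite -expr2 sqr_sqrtr.
have h0 : 0 <= Num.sqrt 5 :> R by apply: sqrtr_ge0.
by rewrite /golden; nra.
Qed.

Lemma golden_lt : phi < 17 / 10.
Proof.
have h : Num.sqrt 5 * Num.sqrt 5 = 5 :> R by rewrite -expr2 sqr_sqrtr.
have h0 : 0 <= Num.sqrt 5 :> R by apply: sqrtr_ge0.
by rewrite /golden; nra.
Qed.

Lemma golden_gt0 : 0 < phi.
Proof. by have := golden_gt; lra. Qed.

Lemma goldenV : phi^-1 = phi - 1.
Proof.
have h := golden_sqr; have h0 := golden_gt0.
by apply: (mulfI (lt0r_neq0 h0)); rewrite mulfV ?lt0r_neq0//; lra.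
Qed.

(** Identities over [Q(phi)] are checked by exhibiting the cofactor of the
    minimal polynomial of the golden ratio. *)
Lemma golden_eq (k x y : R) : x - y = k * (phi * phi - phi - 1) -> x = y.
Proof.
rewrite golden_sqr => h; apply/eqP; rewrite -subr_eq0 h.
by apply/eqP; ring.
Qed.

(** [cos (pi / 5)] is the positive root of [4 c^2 - 2 c - 1], a factor of the
    equation [cos (3 x) = - cos (2 x)]. *)
Lemma cos_pi5 : cos (pi / 5 : R) = phi / 2.
Proof.
set c := cos (pi / 5).
have pi0 : 0 < pi :> R by apply: pi_gt0.
have c0 : 0 < c by apply: cos_gt0_pihalf; apply/andP; split; lra.
have s0 : 0 < sin (pi / 5 : R) by apply: sin_gt0_pi; apply/andP; split; lra.
have c2 : cos (pi / 5 + pi / 5) = 2 * c * c - 1 :> R.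
  by rewrite cosD -/c; have := cos2Dsin2 (pi / 5 : R); rewrite -/c; lra.
have s2 : sin (pi / 5 + pi / 5) = 2 * sin (pi / 5) * c :> R.
  by rewrite sinD -/c; ring.
have c3 : cos (pi / 5 + pi / 5 + pi / 5) = (2 * c * c - 1) * c - 2 * (1 - c * c) * c.
  rewrite cosD c2 s2 -/c.
  by have := cos2Dsin2 (pi / 5 : R); rewrite -/c; nra.
have e : cos (pi / 5 + pi / 5 + pi / 5) = - cos (pi / 5 + pi / 5) :> R.
  rewrite -[in RHS]cosN -cosDpi; congr cos; lra.
have {e} e : (c + 1) * (4 * c * c - 2 * c - 1) = 0.
  by move: e; rewrite c3 c2 => e; lra.
have g := golden_sqr; have g0 := golden_gt.
have {e} e : 4 * c * c - 2 * c - 1 = 0.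
  by move/eqP: e; rewrite mulf_eq0 => /orP[/eqP|/eqP//]; lra.
have : (2 * c - phi) * (2 * c + phi - 1) = 0 by nra.
move=> /eqP; rewrite mulf_eq0 => /orP[] /eqP; first by lra.
by nra.
Qed.

Lemma cos_3pi5 : cos (3 * pi / 5 : R) = (1 - phi) / 2.
Proof.
have c2 : cos (pi / 5 + pi / 5) = 2 * (phi / 2) * (phi / 2) - 1 :> R.
  by rewrite cosD cos_pi5; have := cos2Dsin2 (pi / 5 : R); rewrite cos_pi5; lra.
have -> : (3 * pi / 5 : R) = - (pi / 5 + pi / 5) + pi by lra.
rewrite cosDpi cosN c2; have := golden_sqr; lra.
Qed.

End Golden.

(** * Plane vectors *)
Section Vectors.
Context {R : realType}.
Implicit Types u v w x : 'rV[R]_2.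

Lemma row2P u v : u 0 0 = v 0 0 -> u 0 1 = v 0 1 -> u = v.
Proof.
move=> h0 h1; apply/rowP => i; case: i => [[|[|//]]] hi.
- by rewrite (_ : Ordinal hi = 0) //; apply: val_inj.
- by rewrite (_ : Ordinal hi = 1) //; apply: val_inj.
Qed.

Lemma dotE u v : dot u v = u 0 0 * v 0 0 + u 0 1 * v 0 1.
Proof.
rewrite /dot mxE big_ord_recl big_ord1 !mxE.
by rewrite (_ : lift ord0 ord0 = 1)//; apply: val_inj.
Qed.

Definition cross u v : R := u 0 0 * v 0 1 - u 0 1 * v 0 0.

Lemma lagrange u v : cross u v ^+ 2 = dot u u * dot v v - dot u v ^+ 2.
Proof. by rewrite !dotE /cross; ring. Qed.

Lemma dot_ge0 u : 0 <= dot u u.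
Proof. by rewrite dotE -!expr2 addr_ge0 ?sqr_ge0. Qed.

Lemma dot_eq0 u : dot u u = 0 -> u = 0.
Proof.
rewrite dotE -!expr2 => /eqP; rewrite paddr_eq0 ?sqr_ge0// !sqrf_eq0.
by move=> /andP[/eqP h0 /eqP h1]; apply: row2P; rewrite ?mxE.
Qed.

Lemma enorm_sqr u : enorm u * enorm u = dot u u.
Proof. by rewrite -expr2 sqr_sqrtr// dot_ge0. Qed.

Lemma enorm_ge0 u : 0 <= enorm u.
Proof. exact: sqrtr_ge0. Qed.

Lemma dot_comb a b c d u w :
  dot (a *: u + b *: w) (c *: u + d *: w) =
  a * c * dot u u + (a * d + b * c) * dot u w + b * d * dot w w.
Proof. by rewrite !dotE !mxE; ring. Qed.

Lemma cauchy_schwarz u v : dot u v ^+ 2 <= dot u u * dot v v.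
Proof. by rewrite -subr_ge0 -lagrange sqr_ge0. Qed.

Lemma dot_le_enorm u v : `|dot u v| <= enorm u * enorm v.
Proof.
rewrite -(ger0_norm (mulr_ge0 (enorm_ge0 u) (enorm_ge0 v))).
rewrite -ler_sqr ?nnegrE ?normr_ge0// !real_normK ?num_real// exprMn.
by rewrite (expr2 (enorm u)) (expr2 (enorm v)) !enorm_sqr cauchy_schwarz.
Qed.

Lemma enormD u v : enorm (u + v) <= enorm u + enorm v.
Proof.
have h := addr_ge0 (enorm_ge0 u) (enorm_ge0 v).
rewrite -(ger0_norm h) -(ger0_norm (enorm_ge0 (u + v))).
rewrite -ler_sqr ?nnegrE ?normr_ge0// !real_normK ?num_real// expr2 enorm_sqr.
have -> : dot (u + v) (u + v) = dot u u + 2 * dot u v + dot v v.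
  by rewrite !dotE !mxE; ring.
have := dot_le_enorm u v; have := ler_norm (dot u v).
by rewrite sqrrD !(expr2 (enorm _)) !enorm_sqr mulr2n; lra.
Qed.

Lemma enormN u : enorm (- u) = enorm u.
Proof. by rewrite /enorm; congr Num.sqrt; rewrite !dotE !mxE; ring. Qed.

Lemma enormZ a u : enorm (a *: u) = `|a| * enorm u.
Proof.
rewrite /enorm -sqrtr_sqr -sqrtrM ?sqr_ge0//; congr Num.sqrt.
by rewrite !dotE !mxE; ring.
Qed.

Lemma enormB u v : enorm (u - v) = enorm (v - u).
Proof. by rewrite -enormN opprB. Qed.

Lemma dist_triangle x u v : enorm (x - v) <= enorm (x - u) + enorm (u - v).
Proof. by rewrite (_ : x - v = (x - u) + (u - v)) ?enormD// addrA subrK. Qed.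

End Vectors.

(** * The substitution in barycentric coordinates *)
Section Coordinates.
Context {R : realType}.
Local Notation phi := (golden R).

(** How a fixed point of the plane sits with respect to a triangle: the type of
    the triangle ([true] for type 1) and the barycentric coordinates of the
    point.  All combinatorial properties of supertiles below are statements
    about these data. *)
Definition position : Type := (bool * (R * R * R))%type.

(** The coordinates with respect to the smaller triangles, factored so that
    their signs can be read off. *)
Definition kids (s : position) : seq position :=
  let: (k, (a, b, c)) := s in
  if k then
    [:: (true, (phi * (phi * b), c - phi * b, a));
        (true, (phi * a, phi * c, (phi - 1) * (phi * b - a - c)));
        (false, (phi * c, phi * (phi * b - c), a + c - phi * b))]
  else
    [:: (false, (c, phi * (phi * a), b - phi * a));
        (true, (phi * b, c, (phi - 1) * (phi * a - b)))].

Fixpoint descendants n (s : position) : seq position :=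
  if n is n'.+1 then flatten [seq descendants n' s' | s' <- kids s]
  else [:: s].

Definition barycentric (s : position) :=
  let: (k, (a, b, c)) := s in a + b + c = 1.

Definition inside (s : position) :=
  let: (k, (a, b, c)) := s in [&& 0 < a, 0 < b & 0 < c].

Definition within (s : position) :=
  let: (k, (a, b, c)) := s in [&& 0 <= a, 0 <= b & 0 <= c].

Let g2 := @golden_sqr R.
Let gl := @golden_gt R.

Let p0 : 0 < phi.
Proof. exact: golden_gt0. Qed.
Let p1 : 0 < phi - 1.
Proof. by have := gl; lra. Qed.

Lemma golden_mulmul (x : R) : phi * (phi * x) = phi * x + x.
Proof. by rewrite mulrA g2 mulrDl mul1r. Qed.

Lemma inside_within s : inside s -> within s.
Proof. by case: s => k [[a b] c] /= /and3P[/ltW-> /ltW-> /ltW->]. Qed.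

Lemma kids_barycentric s s' :
  barycentric s -> s' \in kids s -> barycentric s'.
Proof.
case: s => [[] [[a b] c]] /= h; rewrite !inE.
- by move=> /or3P[] /eqP -> /=; have := golden_mulmul b; lra.
- by move=> /orP[] /eqP -> /=; have := golden_mulmul a; lra.
Qed.

Lemma kids_within s s' : s' \in kids s -> within s' -> within s.
Proof.
have P0 := p0; have P1 := p1.
case: s => [[] [[a b] c]] /=; rewrite !inE.
- move=> /or3P[] /eqP -> /=; do ?rewrite (pmulr_rge0 _ p0) ?(pmulr_rge0 _ p1).
  + by move=> /and3P[h1 h2 h3]; apply/and3P; split; nra.
  + by move=> /and3P[h1 h2 h3]; apply/and3P; split; nra.
  + by move=> /and3P[h1 h2 h3]; apply/and3P; split; nra.
- move=> /orP[] /eqP -> /=; do ?rewrite (pmulr_rge0 _ p0) ?(pmulr_rge0 _ p1).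
  + by move=> /and3P[h1 h2 h3]; apply/and3P; split; nra.
  + by move=> /and3P[h1 h2 h3]; apply/and3P; split; nra.
Qed.

Lemma kids_inside s s' : s' \in kids s -> inside s' -> inside s.
Proof.
have P0 := p0; have P1 := p1.
case: s => [[] [[a b] c]] /=; rewrite !inE.
- move=> /or3P[] /eqP -> /=; do ?rewrite (pmulr_rgt0 _ p0) ?(pmulr_rgt0 _ p1).
  + by move=> /and3P[h1 h2 h3]; apply/and3P; split; nra.
  + by move=> /and3P[h1 h2 h3]; apply/and3P; split; nra.
  + by move=> /and3P[h1 h2 h3]; apply/and3P; split; nra.
- move=> /orP[] /eqP -> /=; do ?rewrite (pmulr_rgt0 _ p0) ?(pmulr_rgt0 _ p1).
  + by move=> /and3P[h1 h2 h3]; apply/and3P; split; nra.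
  + by move=> /and3P[h1 h2 h3]; apply/and3P; split; nra.
Qed.

Lemma descendants_within n s s' :
  s' \in descendants n s -> within s' -> within s.
Proof.
elim: n s => [|n IH] s /=; first by rewrite inE => /eqP->.
move=> /flattenP[l /mapP[u us ->] s'u] /(IH _ s'u); exact: kids_within.
Qed.

Lemma descendants_inside n s s' :
  s' \in descendants n s -> inside s' -> inside s.
Proof.
elim: n s => [|n IH] s /=; first by rewrite inE => /eqP->.
move=> /flattenP[l /mapP[u us ->] s'u] /(IH _ s'u); exact: kids_inside.
Qed.

Lemma descendants_barycentric n s s' :
  barycentric s -> s' \in descendants n s -> barycentric s'.
Proof.
elim: n s => [|n IH] s hs /=; first by rewrite inE => /eqP->.
move=> /flattenP[l /mapP[u us ->] s'u].
by apply: IH s'u; apply: kids_barycentric us.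
Qed.

Lemma count_within0 n s : ~~ within s -> count within (descendants n s) = 0.
Proof.
move=> h; apply/eqP; rewrite -leqn0 leqNgt -has_count; apply/hasPn => s' s's.
by apply: contra h; apply: descendants_within s's.
Qed.

(** The open children of a triangle are disjoint from the other closed
    children, so a point in the open interior of a tile of a patch belongs to
    no other closed tile of the patch. *)
Lemma count_within_inside n s :
  has inside (descendants n s) -> count within (descendants n s) = 1%N.
Proof.
have P0 := p0; have P1 := p1.
elim: n s => [|n IH] s; first by rewrite /= orbF addn0 => /inside_within ->.
have kid u : has inside (descendants n u) -> inside u.
  by move=> /hasP[s' s'u is']; apply: descendants_inside s'u is'.
have none u v : (inside u -> ~~ within v) -> has inside (descendants n u) ->
    count within (descendants n v) = 0%N.
  by move=> h /kid /h; apply: count_within0.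
case: s => [[] [[a b] c]] /=; rewrite !has_cat !count_cat /= orbF addn0.
- move=> /or3P[] h; rewrite (IH _ h) !(none _ _ _ h)//=;
    do ?rewrite (pmulr_rgt0 _ p0) ?(pmulr_rgt0 _ p1);
    do ?rewrite (pmulr_rge0 _ p0) ?(pmulr_rge0 _ p1);
    move=> /and3P[h1 h2 h3]; apply/negP => /and3P[h4 h5 h6]; lra.
- move=> /orP[] h; rewrite (IH _ h) !(none _ _ _ h)//=;
    do ?rewrite (pmulr_rgt0 _ p0) ?(pmulr_rgt0 _ p1);
    do ?rewrite (pmulr_rge0 _ p0) ?(pmulr_rge0 _ p1);
    move=> /and3P[h1 h2 h3]; apply/negP => /and3P[h4 h5 h6]; lra.
Qed.


(** Corner angles in units of a tenth of a full turn: the angles are 36, 72, 72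
    degrees in type 0 and 108, 36, 36 degrees in type 1. *)
Definition corner_weight (s : position) : nat :=
  let: (k, (a, b, c)) := s in
  if (b == 0) && (c == 0) then (if k then 3 else 1)%N
  else if (a == 0) && (c == 0) then (if k then 1 else 2)%N
  else if (a == 0) && (b == 0) then (if k then 1 else 2)%N
  else 0%N.

Definition total_weight n s := (\sum_(s' <- descendants n s) corner_weight s')%N.

Lemma total_weight0 s : total_weight 0 s = corner_weight s.
Proof. by rewrite /total_weight big_seq1. Qed.

Lemma total_weightS n s :
  total_weight n.+1 s = (\sum_(s' <- kids s) total_weight n s')%N.
Proof. by rewrite /total_weight /= big_flatten big_map. Qed.

Lemma total_weightS_true n a b c x y z :
  total_weight n (true, (phi * (phi * b), c - phi * b, a)) = x ->
  total_weight n (true, (phi * a, phi * c, (phi - 1) * (phi * b - a - c))) = y ->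
  total_weight n (false, (phi * c, phi * (phi * b - c), a + c - phi * b)) = z ->
  total_weight n.+1 (true, (a, b, c)) = (x + (y + z))%N.
Proof. by rewrite total_weightS !big_cons big_nil addn0 => -> -> ->. Qed.

Lemma total_weightS_false n a b c x y :
  total_weight n (false, (c, phi * (phi * a), b - phi * a)) = x ->
  total_weight n (true, (phi * b, c, (phi - 1) * (phi * a - b))) = y ->
  total_weight n.+1 (false, (a, b, c)) = (x + y)%N.
Proof. by rewrite total_weightS !big_cons big_nil addn0 => -> ->. Qed.

Lemma total_weight_out n k a b c : a + b + c = 1 ->
  [|| a < 0, b < 0 | c < 0] -> total_weight n (k, (a, b, c)) = 0%N.
Proof.
move=> h out; rewrite /total_weight big_seq big1// => -[k' [[a' b'] c']] s's.
have : ~~ within (k', (a', b', c')).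
  apply/negP => /(descendants_within s's) /and3P[h1 h2 h3].
  by move: out => /or3P[]; lra.
have := @descendants_barycentric _ (k, (a, b, c)) _ h s's.
rewrite /= => h' nw; case: ifP => [/andP[/eqP b0 /eqP c0]|_].
  by case/negP: nw; apply/and3P; split; lra.
case: ifP => [/andP[/eqP a0 /eqP c0]|_].
  by case/negP: nw; apply/and3P; split; lra.
case: ifP => [/andP[/eqP a0 /eqP b0]|//].
by case/negP: nw; apply/and3P; split; lra.
Qed.

(** The substitution either leaves a corner alone or splits it, as the angle 72
    into 36 + 36 and the angle 108 into 36 + 72. *)
Lemma total_weight_corner n k a b c :
  [/\ b = 0 -> c = 0 -> a = 1 ->
      total_weight n (k, (a, b, c)) = (if k then 3 else 1)%N,
      a = 0 -> c = 0 -> b = 1 ->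
      total_weight n (k, (a, b, c)) = (if k then 1 else 2)%N &
      a = 0 -> b = 0 -> c = 1 ->
      total_weight n (k, (a, b, c)) = (if k then 1 else 2)%N].
Proof.
have P0 := p0; have P1 := p1.
elim: n k a b c => [|n IH] k a b c.
  by split=> e1 e2 e3; rewrite total_weight0 /= e1 e2 e3 ?eqxx ?oner_eq0 ?andbF.
have A k' a' b' c' (eb : b' = 0) (ec : c' = 0) (ea : a' = 1) :
    total_weight n (k', (a', b', c')) = (if k' then 3 else 1)%N.
  by case: (IH k' a' b' c') => + _ _; apply.
have B k' a' b' c' (ea : a' = 0) (ec : c' = 0) (eb : b' = 1) :
    total_weight n (k', (a', b', c')) = (if k' then 1 else 2)%N.
  by case: (IH k' a' b' c') => _ + _; apply.
have C k' a' b' c' (ea : a' = 0) (eb : b' = 0) (ec : c' = 1) :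
    total_weight n (k', (a', b', c')) = (if k' then 1 else 2)%N.
  by case: (IH k' a' b' c') => _ _; apply.
have OB k' (a' b' c' : R) (h : a' + b' + c' = 1) (hb : b' < 0) :
    total_weight n (k', (a', b', c')) = 0%N.
  by apply: total_weight_out => //; rewrite hb orbT.
have OC k' (a' b' c' : R) (h : a' + b' + c' = 1) (hc : c' < 0) :
    total_weight n (k', (a', b', c')) = 0%N.
  by apply: total_weight_out => //; rewrite hc !orbT.
have G := g2.
split=> e1 e2 e3; subst; case: k.
- by rewrite (total_weightS_true (C _ _ _ _ _ _ _)
    (OC _ _ _ _ _ _) (C _ _ _ _ _ _ _)) //; lra.
- by rewrite (total_weightS_false (OC _ _ _ _ _ _) (C _ _ _ _ _ _ _)) //; lra.
- by rewrite (total_weightS_true (OB _ _ _ _ _ _)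
    (C _ _ _ _ _ _ _) (OC _ _ _ _ _ _)) //; lra.
- by rewrite (total_weightS_false (C _ _ _ _ _ _ _) (OC _ _ _ _ _ _)) //; lra.
- by rewrite (total_weightS_true (B _ _ _ _ _ _ _)
    (OC _ _ _ _ _ _) (OB _ _ _ _ _ _)) //; lra.
- by rewrite (total_weightS_false (A _ _ _ _ _ _ _) (B _ _ _ _ _ _ _)) //; lra.
Qed.


(** The edges of tiles fall into four classes of directed segments, which the
    substitution subdivides by rules that do not depend on the tile carrying
    the edge.  [apex] is the leg [AB], directed from [A] to [B] in type 0 and
    from [B] to [A] in type 1; [leg2] is the leg [AC]; [base0] and [base1] are
    the bases [BC] of the two types. *)
Inductive edge_class := apex | leg2 | base0 | base1.

(** Whether a point of an edge becomes a vertex depends on the class of the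
    edge and on the parameter [s] of the point only; the cut is at
    [s = phi^-1]. *)
Fixpoint splits n (e : edge_class) (s : R) : bool :=
  if n is n'.+1 then
    match e with
    | apex => if phi * s == 1 then true
              else if phi * s < 1 then splits n' leg2 (1 - phi * s)
              else splits n' base0 (phi * (phi * s - 1))
    | leg2 => splits n' base1 (1 - s)
    | base0 => splits n' leg2 (1 - s)
    | base1 => if phi * s == 1 then true
              else if phi * s < 1 then splits n' base1 (1 - phi * s)
              else splits n' apex (phi * (phi * (1 - s)))
    end
  else false.

(** A point of an open edge lies on an open edge of a single child as long as
    the edge is not cut there; when it is cut, the corners of the children at
    the cut form a straight angle.  Each case of the induction step is one of
    these two. *)
Lemma total_weight_edge n k a b c : a + b + c = 1 ->
  [/\ c = 0 -> 0 < a -> 0 < b -> total_weight n (k, (a, b, c)) =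
        (5 * splits n apex (if k then a else b))%N,
      b = 0 -> 0 < a -> 0 < c -> total_weight n (k, (a, b, c)) =
        (5 * splits n leg2 c)%N &
      a = 0 -> 0 < b -> 0 < c -> total_weight n (k, (a, b, c)) =
        (5 * splits n (if k then base1 else base0) c)%N].
Proof.
have P0 := p0; have P1 := p1; have G := g2; have GL := gl.
elim: n k a b c => [|n IH] k a b c h.
  split=> e1 e2 e3; rewrite total_weight0 /= muln0 e1 ?(gt_eqF e2) ?(gt_eqF e3);
  by rewrite ?andbF.
have AB k' a' b' c' : c' = 0 -> 0 < a' -> 0 < b' -> a' + b' + c' = 1 ->
   total_weight n (k', (a', b', c')) =
   (5 * splits n apex (if k' then a' else b'))%N.
  by move=> e1 e2 e3 e4; case: (IH k' a' b' c' e4) => + _ _; apply.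
have AC k' a' b' c' s : b' = 0 -> 0 < a' -> 0 < c' -> a' + b' + c' = 1 ->
   c' = s -> total_weight n (k', (a', b', c')) = (5 * splits n leg2 s)%N.
  by move=> e1 e2 e3 e4 <-; case: (IH k' a' b' c' e4) => _ + _; apply.
have BC k' a' b' c' s : a' = 0 -> 0 < b' -> 0 < c' -> a' + b' + c' = 1 ->
   c' = s -> total_weight n (k', (a', b', c')) =
   (5 * splits n (if k' then base1 else base0) s)%N.
  by move=> e1 e2 e3 e4 <-; case: (IH k' a' b' c' e4) => _ _; apply.
have A k' a' b' c' (eb : b' = 0) (ec : c' = 0) (ea : a' = 1) :
    total_weight n (k', (a', b', c')) = (if k' then 3 else 1)%N.
  by case: (total_weight_corner n k' a' b' c') => + _ _; apply.
have B k' a' b' c' (ea : a' = 0) (ec : c' = 0) (eb : b' = 1) :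
    total_weight n (k', (a', b', c')) = (if k' then 1 else 2)%N.
  by case: (total_weight_corner n k' a' b' c') => _ + _; apply.
have OB k' (a' b' c' : R) (h' : a' + b' + c' = 1) (hb : b' < 0) :
    total_weight n (k', (a', b', c')) = 0%N.
  by apply: total_weight_out => //; rewrite hb orbT.
have OC k' (a' b' c' : R) (h' : a' + b' + c' = 1) (hc : c' < 0) :
    total_weight n (k', (a', b', c')) = 0%N.
  by apply: total_weight_out => //; rewrite hc !orbT.
split=> e1 e2 e3.
- case: k; rewrite [splits _ _ _]/=.
  + have [e4|e4] := eqVneq (phi * a) 1.
      rewrite (total_weightS_true (OB _ _ _ _ _ _)
        (A _ _ _ _ _ _ _) (B _ _ _ _ _ _ _)) //; nra.
    have [e5|e5] := ltrP (phi * a) 1.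
      rewrite (total_weightS_true (OB _ _ _ _ _ _)
        (@AC _ _ _ _ (1 - phi * a) _ _ _ _ _) (OC _ _ _ _ _ _)) ?add0n ?addn0 //; nra.
    have {}e5 : 1 < phi * a by rewrite lt_neqAle eq_sym e4.
    rewrite (total_weightS_true (OB _ _ _ _ _ _) (OC _ _ _ _ _ _)
        (@BC _ _ _ _ (phi * (phi * a - 1)) _ _ _ _ _)) ?add0n ?addn0 //; nra.
  + have [e4|e4] := eqVneq (phi * b) 1.
      rewrite (total_weightS_false (B _ _ _ _ _ _ _) (A _ _ _ _ _ _ _)) //; nra.
    have [e5|e5] := ltrP (phi * b) 1.
      rewrite (total_weightS_false (OC _ _ _ _ _ _)
        (@AC _ _ _ _ (1 - phi * b) _ _ _ _ _)) ?add0n ?addn0 //; nra.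
    have {}e5 : 1 < phi * b by rewrite lt_neqAle eq_sym e4.
    rewrite (total_weightS_false (@BC _ _ _ _ (phi * (phi * b - 1)) _ _ _ _ _)
       (OC _ _ _ _ _ _)) ?add0n ?addn0 //; nra.
- case: k; rewrite [splits _ _ _]/=.
  + rewrite (total_weightS_true (@BC _ _ _ _ (1 - c) _ _ _ _ _)
       (OC _ _ _ _ _ _) (OB _ _ _ _ _ _)) ?add0n ?addn0 //; nra.
  + rewrite (total_weightS_false (OC _ _ _ _ _ _)
       (@BC _ _ _ _ (1 - c) _ _ _ _ _)) ?add0n ?addn0 //; nra.
- case: k; rewrite [splits _ _ _]/=.
  + have [e4|e4] := eqVneq (phi * c) 1.
      rewrite (total_weightS_true (A _ _ _ _ _ _ _)
        (B _ _ _ _ _ _ _) (A _ _ _ _ _ _ _)) //; nra.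
    have [e5|e5] := ltrP (phi * c) 1.
      rewrite (total_weightS_true (OB _ _ _ _ _ _)
        (@BC _ _ _ _ (1 - phi * c) _ _ _ _ _) (OC _ _ _ _ _ _)) ?add0n ?addn0 //; nra.
    have {}e5 : 1 < phi * c by rewrite lt_neqAle eq_sym e4.
    have <- : phi * (phi * b) = phi * (phi * (1 - c)) by congr (_ * (_ * _)); lra.
    rewrite (total_weightS_true (AB _ _ _ _ _ _ _ _)
      (OC _ _ _ _ _ _) (OB _ _ _ _ _ _)) ?add0n ?addn0 //; nra.
  + rewrite (total_weightS_false
       (@AC _ _ _ _ (1 - c) _ _ _ _ _) (OC _ _ _ _ _ _)) ?add0n ?addn0 //; nra.
Qed.
(** A point of the open interior reaches, at some level, the open interior of
    an edge shared by two sibling tiles; the shared edge has the same class in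
    both, so the two half turns appear together. *)
Lemma total_weight_inside n k (a b c : R) : a + b + c = 1 ->
  0 < a -> 0 < b -> 0 < c ->
  total_weight n (k, (a, b, c)) = 0%N \/ total_weight n (k, (a, b, c)) = 10%N.
Proof.
have P0 := p0; have P1 := p1; have G := g2; have GL := gl.
elim: n k a b c => [|n IH] k a b c h ha hb hc.
  by left; rewrite total_weight0 /= !gt_eqF.
have AB k' (a' b' c' s : R) : c' = 0 -> 0 < a' -> 0 < b' -> a' + b' + c' = 1 ->
   (if k' then a' else b') = s ->
   total_weight n (k', (a', b', c')) = (5 * splits n apex s)%N.
  by move=> e1 e2 e3 e4 <-; case: (total_weight_edge n k' e4) => + _ _; apply.
have AC k' (a' b' c' s : R) : b' = 0 -> 0 < a' -> 0 < c' -> a' + b' + c' = 1 ->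
   c' = s -> total_weight n (k', (a', b', c')) = (5 * splits n leg2 s)%N.
  by move=> e1 e2 e3 e4 <-; case: (total_weight_edge n k' e4) => _ + _; apply.
have OB k' (a' b' c' : R) (h' : a' + b' + c' = 1) (hb' : b' < 0) :
    total_weight n (k', (a', b', c')) = 0%N.
  by apply: total_weight_out => //; rewrite hb' orbT.
have OC k' (a' b' c' : R) (h' : a' + b' + c' = 1) (hc' : c' < 0) :
    total_weight n (k', (a', b', c')) = 0%N.
  by apply: total_weight_out => //; rewrite hc' !orbT.
have double (q : bool) : (5 * q + 5 * q = 0 \/ 5 * q + 5 * q = 10)%N.
  by case: q; [right|left].
have Ea := golden_mulmul a; have Eb := golden_mulmul b.
have pa := mulr_gt0 P0 ha; have pb := mulr_gt0 P0 hb; have pc := mulr_gt0 P0 hc.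
have ppa := mulr_gt0 P0 pa; have ppb := mulr_gt0 P0 pb.
case: k.
- have [e|e|e] := ltrgtP c (phi * b).
  + have pe : 0 < phi * (phi * b - c) by rewrite pmulr_rgt0// subr_gt0.
    have [e'|e'|e'] := ltrgtP (a + c) (phi * b).
    * have pe' : 0 < (phi - 1) * (phi * b - a - c) by rewrite pmulr_rgt0//; lra.
      rewrite (total_weightS_true (OB _ _ _ _ _ _) erefl (OC _ _ _ _ _ _));
        rewrite ?add0n ?addn0; try by [apply: IH => //; lra|lra].
    * have pe' : 0 < (phi - 1) * (a + c - phi * b) by rewrite pmulr_rgt0//; lra.
      rewrite (total_weightS_true (OB _ _ _ _ _ _) (OC _ _ _ _ _ _) erefl);
        rewrite ?add0n ?addn0; try by [apply: IH => //; lra|lra].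
    * have pe' : (phi - 1) * (phi * b - a - c) = 0 by rewrite -e'; ring.
      rewrite (total_weightS_true (OB _ _ _ _ _ _)
        (@AB _ _ _ _ (phi * a) _ _ _ _ _) (@AB _ _ _ _ (phi * a) _ _ _ _ _)) //;
        rewrite ?add0n -?e'; try by [exact: double|lra].
  + have pe : 0 < (phi - 1) * (a + c - phi * b) by rewrite pmulr_rgt0//; lra.
    have pe' : 0 < phi * (c - phi * b) by rewrite pmulr_rgt0// subr_gt0.
    rewrite (total_weightS_true erefl (OC _ _ _ _ _ _) (OB _ _ _ _ _ _));
        rewrite ?add0n ?addn0; try by [apply: IH => //; lra|lra].
  + have pe : 0 < (phi - 1) * a by rewrite pmulr_rgt0.
    have pe' : phi * (phi * b - c) = 0 by rewrite -e; ring.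
    rewrite (total_weightS_true (@AC _ _ _ _ a _ _ _ _ _) (OC _ _ _ _ _ _)
      (@AC _ _ _ _ a _ _ _ _ _)) //; rewrite ?add0n //; by [exact: double|lra].
- have [e|e|e] := ltrgtP b (phi * a).
  + have pe : 0 < (phi - 1) * (phi * a - b) by rewrite pmulr_rgt0// subr_gt0.
    rewrite (total_weightS_false (OC _ _ _ _ _ _) erefl);
        rewrite ?add0n ?addn0; try by [apply: IH => //; lra|lra].
  + have pe : 0 < (phi - 1) * (b - phi * a) by rewrite pmulr_rgt0// subr_gt0.
    rewrite (total_weightS_false erefl (OC _ _ _ _ _ _));
        rewrite ?add0n ?addn0; try by [apply: IH => //; lra|lra].
  + have pe : (phi - 1) * (phi * a - b) = 0 by rewrite -e; ring.
    rewrite (total_weightS_false (@AB _ _ _ _ (phi * b) _ _ _ _ _)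
      (@AB _ _ _ _ (phi * b) _ _ _ _ _)) //; rewrite -?e //; by [exact: double|lra].
Qed.

End Coordinates.

(** * Triangles and supertiles *)
Section Supertiles.
Context {R : realType}.
Local Notation phi := (golden R).
Implicit Types (t u : triangle R) (x : 'rV[R]_2).

Definition leg_sqr t : R := let: (A, B, C) := t in dot (B - A) (B - A).

(** The two triangle types, with the cosine of the apex angle written in
    [Q(phi)]; [true] stands for type 1.  In this form the property is inherited
    by the smaller triangles through linear algebra alone. *)
Definition robinson (k : bool) t : Prop :=
  let: (A, B, C) := t in
  [/\ 0 < dot (B - A) (B - A), dot (C - A) (C - A) = dot (B - A) (B - A) &
      dot (B - A) (C - A) =
      (if k then (1 - phi) / 2 else phi / 2) * dot (B - A) (B - A)].

Definition obtuse t : bool := let: (A, B, C) := t in dot (B - A) (C - A) < 0.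

Lemma robinson_obtuse k t : robinson k t -> obtuse t = k.
Proof.
case: t => [[A B] C] [q0 _ /= ->]; have := @golden_gt R => gt.
case: k; first by rewrite pmulr_llt0//; lra.
by apply/negbTE; rewrite -leNgt pmulr_lge0//; lra.
Qed.

Lemma apex_cos (A B C : 'rV[R]_2) (th : R) :
  isosceles (A, B, C) -> apex_angle (A, B, C) = th -> cos th != 0 ->
  [/\ 0 < dot (B - A) (B - A), dot (C - A) (C - A) = dot (B - A) (B - A) &
      dot (B - A) (C - A) = cos th * dot (B - A) (B - A)].
Proof.
move=> [_ leg] <-; rewrite /apex_angle /angle.
have eAC : dot (C - A) (C - A) = dot (B - A) (B - A).
  by rewrite -!enorm_sqr !(enormB _ A); move: leg; rewrite /dist => ->.
have eN : enorm (C - A) = enorm (B - A) by rewrite /enorm eAC.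
rewrite eN enorm_sqr acosK; last first.
  rewrite in_itv /= -ler_norml normrM normfV (ger0_norm (dot_ge0 _)).
  have := dot_le_enorm (B - A) (C - A); rewrite eN enorm_sqr.
  have := dot_ge0 (B - A); rewrite le_eqVlt => /orP[/eqP<-|q0 h].
    by rewrite invr0 mulr0.
  by rewrite ler_pdivrMr// mul1r.
move=> n0; have q0 : dot (B - A) (B - A) != 0.
  by apply: contra n0 => /eqP->; rewrite invr0 mulr0.
by split; rewrite ?divfK// lt_neqAle eq_sym q0 dot_ge0.
Qed.

Lemma type0_robinson t : type0 t -> robinson false t.
Proof.
case: t => [[A B] C] [iso ang]; have := apex_cos iso ang.
by rewrite cos_pi5; apply; rewrite gt_eqF// divr_gt0// golden_gt0.
Qed.

Lemma type1_robinson t : type1 t -> robinson true t.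
Proof.
case: t => [[A B] C] [iso ang]; have := apex_cos iso ang.
rewrite cos_3pi5; apply; rewrite lt_eqF//; have := @golden_gt R; lra.
Qed.

(** The substitution as a function: the type is decided by the sign of a scalar
    product, so that a supertile becomes a list on which one can sum and
    count. *)
Definition children t : seq (triangle R) :=
  let: (A, B, C) := t in
  if obtuse t then
    let Q := B + phi^-1 *: (A - B) in
    let R' := B + phi^-1 *: (C - B) in
    [:: (R', C, A); (Q, R', B); (R', Q, A)]
  else
    let P := A + phi^-1 *: (B - A) in
    [:: (C, P, B); (P, C, A)].

Fixpoint supertile n t : seq (triangle R) :=
  if n is n'.+1 then flatten [seq supertile n' u | u <- children t]
  else [:: t].

(** The Gram matrix of two sides of a smaller triangle, computed in the basis
    [B - A], [C - A]; its legs shrink by the factor [phi^-1], whose square is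
    [2 - phi]. *)
Lemma robinson_comb k (A B C : 'rV[R]_2) k' (A' B' C' : 'rV[R]_2) a b c d :
  robinson k (A, B, C) ->
  let s := if k then (1 - phi) / 2 else phi / 2 in
  let s' := if k' then (1 - phi) / 2 else phi / 2 in
  B' - A' = a *: (B - A) + b *: (C - A) ->
  C' - A' = c *: (B - A) + d *: (C - A) ->
  a * a + 2 * a * b * s + b * b = 2 - phi ->
  c * c + 2 * c * d * s + d * d = 2 - phi ->
  a * c + (a * d + b * c) * s + b * d = s' * (2 - phi) ->
  robinson k' (A', B', C') /\
  leg_sqr (A', B', C') = (2 - phi) * leg_sqr (A, B, C).
Proof.
move=> [q0 eq es] s s' eu ew h1 h2 h3; rewrite /robinson /leg_sqr eu ew.
rewrite !dot_comb eq es -/s -/s'.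
set q := dot _ _ in q0 *.
have e1 : a * a * q + (a * b + b * a) * (s * q) + b * b * q = (2 - phi) * q.
  by rewrite -h1; ring.
have e2 : c * c * q + (c * d + d * c) * (s * q) + d * d * q = (2 - phi) * q.
  by rewrite -h2; ring.
have e3 : a * c * q + (a * d + b * c) * (s * q) + b * d * q = s' * (2 - phi) * q.
  by rewrite -h3; ring.
rewrite e1 e2 e3 mulrA; split=> //; split=> //.
by rewrite pmulr_rgt0//; have := @golden_lt R; lra.
Qed.

Let g2 := @golden_sqr R.
Let g3 : phi * phi * phi = 2 * phi + 1.
Proof. by rewrite g2 mulrDl g2; ring. Qed.

Lemma robinson_children0 A B C : robinson false (A, B, C) ->
  let P := A + phi^-1 *: (B - A) in
  (robinson false (C, P, B) /\
   leg_sqr (C, P, B) = (2 - phi) * leg_sqr (A, B, C)) /\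
  (robinson true (P, C, A) /\
   leg_sqr (P, C, A) = (2 - phi) * leg_sqr (A, B, C)).
Proof.
have h2 := g2; have h3 := g3.
rewrite goldenV => h; split.
- apply: (robinson_comb (a := phi - 1) (b := - 1) (c := 1) (d := - 1) h);
    first [by apply: row2P; rewrite !mxE; ring | lra].
- apply: (robinson_comb (a := 1 - phi) (b := 1) (c := 1 - phi) (d := 0) h);
    first [by apply: row2P; rewrite !mxE; ring | lra].
Qed.

Lemma robinson_children1 A B C : robinson true (A, B, C) ->
  let Q := B + phi^-1 *: (A - B) in
  let R' := B + phi^-1 *: (C - B) in
  [/\ robinson true (R', C, A) /\
      leg_sqr (R', C, A) = (2 - phi) * leg_sqr (A, B, C),
      robinson true (Q, R', B) /\
      leg_sqr (Q, R', B) = (2 - phi) * leg_sqr (A, B, C) &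
      robinson false (R', Q, A) /\
      leg_sqr (R', Q, A) = (2 - phi) * leg_sqr (A, B, C)].
Proof.
have h2 := g2; have h3 := g3.
rewrite goldenV => h; split.
- apply: (robinson_comb (a := phi - 2) (b := 2 - phi) (c := phi - 2)
    (d := 1 - phi) h); first [by apply: row2P; rewrite !mxE; ring | lra].
- apply: (robinson_comb (a := 0) (b := phi - 1) (c := phi - 1)
    (d := 0) h); first [by apply: row2P; rewrite !mxE; ring | lra].
- apply: (robinson_comb (a := 0) (b := 1 - phi) (c := phi - 2)
    (d := 1 - phi) h); first [by apply: row2P; rewrite !mxE; ring | lra].
Qed.

Lemma robinson_children t u : robinson (obtuse t) t -> u \in children t ->
  robinson (obtuse u) u /\ leg_sqr u = (2 - phi) * leg_sqr t.
Proof.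
have w k v : robinson k v /\ leg_sqr v = (2 - phi) * leg_sqr t ->
    robinson (obtuse v) v /\ leg_sqr v = (2 - phi) * leg_sqr t.
  by move=> [/[dup] /robinson_obtuse -> ? ?].
case: t w => [[A B] C] w h; rewrite /children.
case: ifP h => _ h; rewrite !inE.
- have [h1 h2 h3] := robinson_children1 h.
  by move=> /or3P[] /eqP->; apply: w; eassumption.
- have [h1 h2] := robinson_children0 h.
  by move=> /orP[] /eqP->; apply: w; eassumption.
Qed.

Lemma robinson_supertile n t u : robinson (obtuse t) t -> u \in supertile n t ->
  robinson (obtuse u) u /\ leg_sqr u = (2 - phi) ^+ n * leg_sqr t.
Proof.
elim: n t => [|n IH] t h /=; first by rewrite inE => /eqP->; rewrite mul1r.
move=> /flattenP[l /mapP[v vt ->] uv].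
have [hv ev] := robinson_children h vt.
by have [hu ->] := IH v hv uv; rewrite ev exprSr mulrA.
Qed.

(** ** Barycentric coordinates in the plane *)

Definition tri_det t : R := let: (A, B, C) := t in cross (B - A) (C - A).

Definition coords t x : R * R * R :=
  let: (A, B, C) := t in
  let b := cross (x - A) (C - A) / tri_det t in
  let c := cross (B - A) (x - A) / tri_det t in
  (1 - b - c, b, c).

Lemma robinson_det k t : robinson k t ->
  tri_det t ^+ 2 = (if k then (phi + 2) / 4 else (3 - phi) / 4) * leg_sqr t ^+ 2.
Proof.
case: t => [[A B] C] [q0 eq es]; rewrite /tri_det lagrange eq es /leg_sqr.
have h2 := g2; set q := dot _ _; clear es.
by case: k => /=; rewrite -expr2 exprMn -{1}[q ^+ 2]mul1r -mulrBl;
  congr (_ * _); rewrite expr2; lra.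
Qed.

Lemma robinson_det_neq0 k t : robinson k t -> tri_det t != 0.
Proof.
move=> h; rewrite -sqrf_eq0 (robinson_det h) mulf_neq0//.
  by have := @golden_gt R; have := @golden_lt R; case: (k) => *; apply: lt0r_neq0; lra.
by case: t h => [[A B] C] [q0 _ _]; rewrite sqrf_eq0 gt_eqF.
Qed.

Lemma coords_comb A B C x a b c : tri_det (A, B, C) != 0 ->
  coords (A, B, C) x = (a, b, c) -> x = a *: A + b *: B + c *: C.
Proof.
rewrite /coords /= /cross => d0 [<- <- <-]; apply: row2P; rewrite !mxE in d0 *; by field.
Qed.

Lemma coords_uniq A B C x a b c : tri_det (A, B, C) != 0 -> a + b + c = 1 ->
  x = a *: A + b *: B + c *: C -> coords (A, B, C) x = (a, b, c).
Proof.
move=> d0 h ->; have ea : a = 1 - b - c by lra.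
move: d0; rewrite {}ea /coords /= /cross !mxE => d0.
by congr (_, _, _); field.
Qed.

Lemma coords_sum t x a b c : coords t x = (a, b, c) -> a + b + c = 1.
Proof. by case: t => [[A B] C] [<- <- <-]; ring. Qed.

Definition pos t x : position := (obtuse t, coords t x).

(** The geometric substitution acts on coordinates as [kids]: this is what
    reduces the geometry of supertiles to the previous part. *)
Lemma pos_children t x : robinson (obtuse t) t ->
  [seq pos u x | u <- children t] = kids (pos t x).
Proof.
case: t => [[A B] C] h; rewrite /pos.
have d0 := robinson_det_neq0 h.
case E: (coords _ _) => [[a b] c].
have xE := coords_comb d0 E; have s1 := coords_sum E.
have child k' A' B' C' a' b' c' : robinson k' (A', B', C') ->
    barycentric (k', (a', b', c')) -> x = a' *: A' + b' *: B' + c' *: C' ->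
    (obtuse (A', B', C'), coords (A', B', C') x) = (k', (a', b', c')).
  move=> h' s' x'E; congr (_, _); first exact: robinson_obtuse h'.
  by apply: coords_uniq => //; apply: robinson_det_neq0 h'.
have kid s' := @kids_barycentric _ (obtuse (A, B, C), (a, b, c)) s' s1.
move: h kid; rewrite /children; case: ifP => _ h kid.
- have [[h1 _] [h2 _] [h3 _]] := robinson_children1 h.
  congr [:: _; _; _]; (apply: child;
    [by []|by apply: kid; rewrite !inE eqxx ?orbT|]);
    rewrite xE goldenV; apply/rowP => i; rewrite !mxE.
  + by apply: (@golden_eq _ (b * ((phi - 1) * B 0 i - phi * C 0 i))); ring.
  + apply: (@golden_eq _ (- (a * A 0 i + b * B 0 i + c * C 0 i -
      (a + c) * B 0 i))); ring.
  + apply: (@golden_eq _ (- ((phi * b - c) * A 0 i -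
      (phi - 1) * b * B 0 i + c * C 0 i))); ring.
- have [[h1 _] [h2 _]] := robinson_children0 h.
  congr [:: _; _]; (apply: child;
    [by []|by apply: kid; rewrite !inE eqxx ?orbT|]);
    rewrite xE goldenV; apply/rowP => i; rewrite !mxE.
  + by apply: (@golden_eq _ (a * ((phi - 1) * A 0 i - phi * B 0 i))); ring.
  + apply: (@golden_eq _ (- (a * A 0 i - b * A 0 i + b * B 0 i))); ring.
Qed.

Lemma pos_supertile n t x : robinson (obtuse t) t ->
  [seq pos u x | u <- supertile n t] = descendants n (pos t x).
Proof.
elim: n t => [//|n IH] t h.
have -> : descendants n.+1 (pos t x) =
  flatten [seq descendants n s | s <- kids (pos t x)] by [].
rewrite -pos_children// [supertile _ _]/= map_flatten -!map_comp.
congr flatten; apply/eq_in_map => u /(robinson_children h).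
by move=> [hu _]; rewrite /= IH.
Qed.

End Supertiles.

(** * Counting tiles in a supertile *)
Section Counting.
Context {R : realType}.
Local Notation phi := (golden R).
Implicit Types (t u v : triangle R) (x : 'rV[R]_2).

Definition corners t : seq 'rV[R]_2 := let: (A, B, C) := t in [:: A; B; C].

Lemma supertile_inside_uniq n t u v x : robinson (obtuse t) t ->
  u \in supertile n t -> v \in supertile n t ->
  inside (pos u x) -> within (pos v x) -> u = v.
Proof.
move=> ht us vs iu wv.
have c1 : count (fun w => within (pos w x)) (supertile n t) = 1%N.
  rewrite -(count_map (pos ^~ x) within) pos_supertile//.
  apply: count_within_inside; rewrite -pos_supertile// has_map.
  by apply/hasP; exists u.
have : size [seq w <- supertile n t | within (pos w x)] = 1%N by rewrite size_filter.
case E: [seq _ <- _ | _] => [//|w [|//]] _.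
have : u \in [seq w <- supertile n t | within (pos w x)].
  by rewrite mem_filter us (inside_within iu).
have : v \in [seq w <- supertile n t | within (pos w x)].
  by rewrite mem_filter vs wv.
by rewrite E !inE => /eqP -> /eqP ->.
Qed.

Lemma regionE t x : tri_det t != 0 -> region t x <-> within (pos t x).
Proof.
case: t => [[A B] C] d0; case E: (coords (A, B, C) x) => [[a b] c].
rewrite /pos E /=; split.
- move=> [a' [b' [c' [a0 b0 c0 s1 xE]]]].
  by move: (coords_uniq d0 s1 xE); rewrite E => -[-> -> ->]; rewrite a0 b0 c0.
- move=> /and3P[a0 b0 c0]; exists a, b, c.
  by split=> //; [exact: coords_sum E|exact: coords_comb E].
Qed.

Definition centroid t : 'rV[R]_2 :=
  let: (A, B, C) := t in 3^-1 *: A + 3^-1 *: B + 3^-1 *: C.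

Lemma centroid_inside t : tri_det t != 0 -> inside (pos t (centroid t)).
Proof.
case: t => [[A B] C] d0; rewrite /pos (@coords_uniq _ _ _ _ _ 3^-1 3^-1 3^-1)//=.
  by rewrite !invr_gt0 !ltr0n.
lra.
Qed.

Lemma supertile_uniq n t : robinson (obtuse t) t -> uniq (supertile n t).
Proof.
move=> ht; apply: count_mem_uniq => u; case: (boolP (u \in _)) => [us|]; last first.
  by rewrite -has_pred1 has_count -leqNgt leqn0 => /eqP.
have [hu _] := robinson_supertile ht us.
have iu := centroid_inside (robinson_det_neq0 hu).
apply/eqP; rewrite eqn_leq -has_count has_pred1 us andbT.
have c1 : count (fun w => within (pos w (centroid u))) (supertile n t) = 1%N.
  rewrite -(count_map (pos ^~ _) within) pos_supertile//.
  apply: count_within_inside; rewrite -pos_supertile// has_map.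
  by apply/hasP; exists u.
apply: (@leq_trans (count (fun w => within (pos w (centroid u))) (supertile n t)));
  last by rewrite c1.
by apply: sub_count => w /eqP ->; exact: inside_within iu.
Qed.

(** ** Corner angles *)

Definition angle_weight t x : nat := corner_weight (pos t x).

Lemma coords_corners t : tri_det t != 0 -> let: (A, B, C) := t in
  [/\ coords t A = (1, 0, 0), coords t B = (0, 1, 0) & coords t C = (0, 0, 1)].
Proof.
case: t => [[A B] C] d0; split; apply: coords_uniq => //;
  by rewrite ?addr0 ?add0r ?scale1r ?scale0r ?addr0 ?add0r.
Qed.

Lemma angle_weight_gt0 t x : tri_det t != 0 ->
  (0 < angle_weight t x)%N = (x \in corners t).
Proof.
case: t => [[A B] C] d0; have [eA eB eC] := coords_corners d0.
case E: (coords (A, B, C) x) => [[a b] c].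
have xE := coords_comb d0 E; have s1 := coords_sum E.
have corner y : coords (A, B, C) y = (a, b, c) -> x = y.
  by move=> e; rewrite xE -(coords_comb d0 e).
rewrite /angle_weight /pos E !inE /=; apply/idP/idP.
- case: ifP => [/andP[/eqP b0 /eqP c0] _|_].
    by rewrite (corner A) ?eqxx// eA; congr (_, _, _); lra.
  case: ifP => [/andP[/eqP a0 /eqP c0] _|_].
    by rewrite (corner B) ?eqxx ?orbT// eB; congr (_, _, _); lra.
  case: ifP => [/andP[/eqP a0 /eqP b0] _|//].
  by rewrite (corner C) ?eqxx ?orbT// eC; congr (_, _, _); lra.
- move=> /or3P[] /eqP xe; move: E; rewrite xe ?eA ?eB ?eC => -[<- <- <-];
    rewrite ?eqxx ?oner_eq0 ?andbF //=; by case: ifP.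
Qed.

Lemma corners_uniq t : tri_det t != 0 -> uniq (corners t).
Proof.
case: t => [[A B] C] d0; have [eA eB eC] := coords_corners d0.
have n01 : (1 : R) <> 0 by apply/eqP; exact: oner_neq0.
rewrite /= !inE andbT negb_or -andbA; apply/and3P.
split; apply/eqP => /(congr1 (coords (A, B, C))).
- by rewrite eA eB => -[] /n01.
- by rewrite eA eC => -[] /n01.
- by rewrite eB eC => -[] /n01.
Qed.

Lemma sum_angle_weight t : tri_det t != 0 ->
  (\sum_(x <- corners t) angle_weight t x = 5)%N.
Proof.
case: t => [[A B] C] d0; have [eA eB eC] := coords_corners d0.
rewrite !big_cons big_nil /angle_weight /pos eA eB eC /= !eqxx.
by rewrite oner_eq0 ?andbF; case: ifP.
Qed.

(** The sum is 0 or 10 at an interior point, and the tile [u] makes it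
    positive. *)
Lemma supertile_angle_sum n t u x : robinson (obtuse t) t ->
  inside (pos t x) -> u \in supertile n t -> x \in corners u ->
  (\sum_(v <- supertile n t) angle_weight v x = 10)%N.
Proof.
move=> ht ix us xu.
have e : (\sum_(v <- supertile n t) angle_weight v x)%N = total_weight n (pos t x).
  by rewrite /total_weight -pos_supertile// big_map.
have [hu _] := robinson_supertile ht us.
have p : (0 < total_weight n (pos t x))%N.
  rewrite -e lt0n sum_nat_seq_neq0; apply/hasP; exists u => //=.
  by rewrite -lt0n angle_weight_gt0// (robinson_det_neq0 hu).
rewrite e; move: ix p; rewrite /pos; case E: (coords t x) => [[a b] c] /=.
move=> /and3P[a0 b0 c0].
by case: (total_weight_inside n (obtuse t) (coords_sum E) a0 b0 c0) => ->.
Qed.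

End Counting.

(** * Discrepancy of finite sets of tiles *)
Section Discrepancy.
Context {R : realType}.
Local Notation phi := (golden R).
Implicit Types (t u v : triangle R) (x : 'rV[R]_2).

(** Weights in the ratio of the areas, [phi : 1], scaled so that the excess
    [1 - area_weight] is an eigenvector of the substitution for the small
    eigenvalue [2 - phi = phi ^- 2]. *)
Definition area_weight t : R :=
  if obtuse t then (3 * phi + 1) / 5 else (phi + 2) / 5.

Definition excess t : R := 1 - area_weight t.

Definition touch u v : bool := has (mem (corners u)) (corners v).

(** The frontier is taken outside [F]: in the tiling, the weight of these tiles
    is what is available to compensate the discrepancy of [F]. *)
Definition frontier (F : pred (triangle R)) (s : seq (triangle R)) : nat :=
  count (fun u => ~~ F u && has (fun v => F v && touch u v) s) s.

Definition mixed (F : pred (triangle R)) (s : seq (triangle R)) : bool :=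
  has F s && has (predC F) s.

Let g2 := @golden_sqr R.
Let gl := @golden_gt R.
Let gu := @golden_lt R.

Lemma children_corner t x : x \in corners t ->
  exists2 u, u \in children t & x \in corners u.
Proof.
case: t => [[A B] C]; rewrite /children [corners _]/= !inE.
set P := A + _ *: _; set R' := B + _ *: (C - B); set Q := B + _ *: _.
case: ifP => _ /or3P[] /eqP->.
- by exists (R', C, A); rewrite ?mem_head//= !inE eqxx ?orbT.
- by exists (Q, R', B); rewrite /= !inE eqxx ?orbT.
- by exists (R', C, A); rewrite ?mem_head//= !inE eqxx ?orbT.
- by exists (P, C, A); rewrite /= !inE eqxx ?orbT.
- by exists (C, P, B); rewrite ?mem_head//= !inE eqxx ?orbT.
- by exists (C, P, B); rewrite ?mem_head//= !inE eqxx ?orbT.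
Qed.

Lemma supertile_corner n t x : x \in corners t ->
  exists2 u, u \in supertile n t & x \in corners u.
Proof.
elim: n t => [|n IH] t xt; first by exists t; rewrite ?inE.
have [u ut xu] := children_corner xt; have [v vu xv] := IH _ xu.
by exists v => //; apply/flatten_mapP; exists u.
Qed.

Lemma children_common_corner t :
  exists x, forall u, u \in children t -> x \in corners u.
Proof.
case: t => [[A B] C]; rewrite /children; case: ifP => _.
- exists (B + phi^-1 *: (C - B)) => u; rewrite !inE => /or3P[] /eqP-> /=;
  by rewrite !inE ?eqxx ?orbT.
- by exists C => u; rewrite !inE => /orP[] /eqP-> /=; rewrite !inE ?eqxx ?orbT.
Qed.

(** Sibling supertiles share a corner, so a supertile is connected under
    [touch] and a set of tiles that neither contains nor misses it entirely
    has a frontier in it. *)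
Lemma mixed_frontier n t F : mixed F (supertile n t) ->
  (0 < frontier F (supertile n t))%N.
Proof.
move=> mx; rewrite -has_count; move: mx.
suff: mixed F (supertile n t) -> exists u v, [/\ u \in supertile n t,
    v \in supertile n t, ~~ F u, F v & touch u v].
  move=> + mx => /(_ mx) [u [v [us vs nF Fv uv]]].
  by apply/hasP; exists u; rewrite ?nF//=; apply/hasP; exists v; rewrite ?Fv.
elim: n t => [|n IH] t; first by rewrite /mixed /= !orbF; case: (F t).
have [/hasP[c ct mc] _|/hasPn nomix] :=
    boolP (has (fun c => mixed F (supertile n c)) (children t)).
  have [u [v [uc vc nF Fv uv]]] := IH c mc.
  by exists u, v; split=> //; apply/flatten_mapP; exists c.
move=> /andP[/hasP[v vs Fv] /hasP[u us nFu]].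
have /flatten_mapP[c ct vc] := vs; have /flatten_mapP[c' ct' uc] := us.
have [x xc] := children_common_corner t.
have [v' v'c xv] := supertile_corner n (xc _ ct).
have [u' u'c xu] := supertile_corner n (xc _ ct').
exists u', v'; split=> //.
- by apply/flatten_mapP; exists c'.
- by apply/flatten_mapP; exists c.
- apply/negP => Fu'; have /negP := nomix _ ct'; apply; apply/andP.
  by split; apply/hasP; [exists u'|exists u].
- apply/negPn/negP => Fv'; have /negP := nomix _ ct; apply; apply/andP.
  by split; apply/hasP; [exists v|exists v'].
- by apply/hasP; exists x.
Qed.

Lemma frontier_flatten F (ss : seq (seq (triangle R))) :
  (\sum_(s <- ss) frontier F s <= frontier F (flatten ss))%N.
Proof.
rewrite [X in (_ <= X)%N]/frontier count_flatten sumnE big_map.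
rewrite big_seq [X in (_ <= X)%N]big_seq; apply: leq_sum => s ss_s.
apply: sub_count => u /= /andP[-> /hasP[v vs Fv]] /=.
by apply/hasP; exists v => //; apply/flattenP; exists s.
Qed.

Lemma children_obtuse t : robinson (obtuse t) t ->
  [seq obtuse u | u <- children t] =
  if obtuse t then [:: true; true; false] else [:: false; true].
Proof.
move=> ht; have -> : [seq obtuse u | u <- children t] =
    [seq s.1 | s <- kids (pos t 0)] by rewrite -pos_children// -map_comp.
by rewrite /pos; case: (coords _ _) => [[a b] c]; case: (obtuse t).
Qed.

Lemma children_sum (f : bool -> R) t : robinson (obtuse t) t ->
  \sum_(u <- children t) f (obtuse u) =
  if obtuse t then f true + f true + f false else f false + f true.
Proof.
move=> ht; rewrite -(big_map obtuse predT) children_obtuse//.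
by case: (obtuse t); rewrite !big_cons big_nil addr0 ?addrA.
Qed.

Lemma supertile_excess n t : robinson (obtuse t) t ->
  \sum_(u <- supertile n t) excess u = (2 - phi) ^+ n * excess t.
Proof.
elim: n t => [|n IH] t ht; first by rewrite big_seq1 mul1r.
rewrite /= big_flatten big_map.
have -> : \sum_(u <- children t) \sum_(v <- supertile n u) excess v =
    (2 - phi) ^+ n * \sum_(u <- children t) excess u.
  rewrite mulr_sumr big_seq [RHS]big_seq; apply: eq_bigr => u ut.
  by apply: IH; have [] := robinson_children ht ut.
rewrite (children_sum (fun k => 1 - if k then (3 * phi + 1) / 5
  else (phi + 2) / 5))// exprSr -mulrA; congr (_ * _).
by rewrite /excess /area_weight; have := g2; case: (obtuse t) => ?; lra.
Qed.

(** A level-[n] supertile contained in [F] contributes its own discrepancy,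
    which shrinks like [(2 - phi) ^+ n = phi ^- (2 * n)]; each level
    therefore adds a geometrically decreasing amount to the ratio between
    discrepancy and frontier. *)
Lemma supertile_discrepancy n t F : robinson (obtuse t) t ->
  mixed F (supertile n t) ->
  let D := \sum_(u <- supertile n t | F u) excess u in
  let N := (frontier F (supertile n t))%:R in
  - (2 * (3 - phi) / 5 * (1 - (2 - phi) ^+ n)) * N <= D /\
  D <= (2 * phi - 1) / 5 * (1 - (2 - phi) ^+ n) * N.
Proof.
elim: n t => [|n IH] t ht mx /=; first by move: mx; rewrite /mixed /= !orbF; case: (F t).
have G := g2; have GL := gl; have GU := gu.
set r := (2 - phi) ^+ n.
have r0 : 0 < r by apply: exprn_gt0; lra.
have r1 : r <= 1 by apply: exprn_ile1; lra.
set cm := 2 * (3 - phi) / 5 * (1 - r).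
set cp := (2 * phi - 1) / 5 * (1 - r).
have cm0 : 0 <= cm by apply: mulr_ge0; lra.
have cp0 : 0 <= cp by apply: mulr_ge0; lra.
(* Negative and positive parts of the excess.  Among the children of a tile at
   most one is of type 0, and at most two are of type 1; hence the bounds [dps]
   and [dms]. *)
pose dm k : R := if k then (3 * phi - 4) / 5 else 0.
pose dp k : R := if k then 0 else (3 - phi) / 5.
have child u : u \in children t ->
  - cm * (frontier F (supertile n u))%:R - r * dm (obtuse u) <=
    \sum_(v <- supertile n u | F v) excess v <=
  cp * (frontier F (supertile n u))%:R + r * dp (obtuse u).
  move=> ut; have [hu _] := robinson_children ht ut.
  set N := (frontier _ _)%:R; have N0 : 0 <= N by apply: ler0n.
  have dm0 : 0 <= r * dm (obtuse u).
    by rewrite mulr_ge0 ?(ltW r0)// /dm; case: ifP => _; lra.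
  have dp0 : 0 <= r * dp (obtuse u).
    by rewrite mulr_ge0 ?(ltW r0)// /dp; case: ifP => _; lra.
  have cmN := mulr_ge0 cm0 N0; have cpN := mulr_ge0 cp0 N0.
  have [mu|] := boolP (mixed F (supertile n u)).
    have [h1 h2] := IH u hu mu.
    by rewrite -/r -/cm -/cp -/N in h1 h2; apply/andP; split; lra.
  rewrite negb_and => /orP[/hasPn nF|/hasPn aF].
    by rewrite big_seq_cond big1 => [|v /andP[/nF/negbTE->]]//; apply/andP; split; lra.
  have -> : \sum_(v <- supertile n u | F v) excess v =
      \sum_(v <- supertile n u) excess v.
    rewrite big_seq_cond [RHS]big_seq; apply: eq_bigl => v.
    by case: (boolP (v \in _)) => //= /aF /negPn.
  rewrite supertile_excess// -/r /excess /area_weight.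
  have rp : 0 < r * (3 - phi) by rewrite pmulr_rgt0//; lra.
  have rm : 0 < r * (3 * phi - 4) by rewrite pmulr_rgt0//; lra.
  by rewrite /dm /dp; case: (obtuse u); apply/andP; split; lra.
rewrite big_flatten big_map /=.
set N := (frontier _ _)%:R.
have Nsum : \sum_(u <- children t) (frontier F (supertile n u))%:R <= N.
  rewrite -natr_sum ler_nat.
  by apply: leq_trans (frontier_flatten F _); rewrite big_map.
have N1 : 1 <= N by rewrite ler1n (@mixed_frontier n.+1).
have dms : \sum_(u <- children t) dm (obtuse u) <= 2 * (3 * phi - 4) / 5.
  by rewrite children_sum// /dm; case: (obtuse t); lra.
have dps : \sum_(u <- children t) dp (obtuse u) <= (3 - phi) / 5.
  by rewrite children_sum// /dp; case: (obtuse t); lra.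
have lo : - cm * N - r * (2 * (3 * phi - 4) / 5) <=
    \sum_(u <- children t) \sum_(v <- supertile n u | F v) excess v.
  apply: (@le_trans _ _ (\sum_(u <- children t) (- cm * (frontier F (supertile n u))%:R - r * dm (obtuse u)))).
    by rewrite sumrB -!mulr_sumr; nra.
  by rewrite big_seq [leRHS]big_seq; apply: ler_sum => u /child /andP[].
have hi : \sum_(u <- children t) \sum_(v <- supertile n u | F v) excess v <=
    cp * N + r * ((3 - phi) / 5).
  apply: (@le_trans _ _ (\sum_(u <- children t) (cp * (frontier F (supertile n u))%:R + r * dp (obtuse u)))).
    by rewrite big_seq [leRHS]big_seq; apply: ler_sum => u /child /andP[].
  by rewrite big_split -!mulr_sumr /=; nra.
have rN : r <= r * N by rewrite ler_peMr// ltW.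
rewrite exprS -/r; split.
  apply: le_trans lo; rewrite /cm.
  have -> : - (2 * (3 - phi) / 5 * (1 - (2 - phi) * r)) * N =
    - (2 * (3 - phi) / 5 * (1 - r)) * N - 2 * (3 * phi - 4) / 5 * (r * N).
    by apply: (@golden_eq _ (2 / 5 * r * N)); ring.
  by rewrite lerD2l lerN2; nra.
apply: le_trans hi _; rewrite /cp.
have -> : (2 * phi - 1) / 5 * (1 - (2 - phi) * r) * N =
  (2 * phi - 1) / 5 * (1 - r) * N + (3 - phi) / 5 * (r * N).
  by apply: (@golden_eq _ (2 / 5 * r * N)); ring.
by rewrite lerD2l; nra.
Qed.

(** Summing the geometric series: the constants reached, [(2 * phi - 1) / 5] and
    [2 * (3 - phi) / 5], stay below the smallest area weight and below 1. *)
Lemma supertile_frontier n t F : robinson (obtuse t) t ->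
  mixed F (supertile n t) ->
  let D := \sum_(u <- supertile n t | F u) excess u in
  let N := (frontier F (supertile n t))%:R in
  - N <= D /\ D <= (phi + 2) / 5 * N.
Proof.
move=> ht mx; have [lo hi] := supertile_discrepancy ht mx.
move=> D N; rewrite -/D -/N in lo hi.
have GL := gl; have GU := gu.
have N0 : 0 <= N by apply: ler0n.
set r := (2 - phi) ^+ n in lo hi.
have r0 : 0 < r by apply: exprn_gt0; lra.
have r1 : r <= 1 by apply: exprn_ile1; lra.
split.
  apply: le_trans lo; rewrite -[leLHS]mulN1r; apply: ler_wpM2r => //.
  by rewrite lerN2; nra.
by apply: le_trans hi _; apply: ler_wpM2r => //; nra.
Qed.

End Discrepancy.

(** * Finite patches are parts of supertiles *)
Section Patches.
Context {R : realType}.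
Local Notation phi := (golden R).
Implicit Types (t u v : triangle R) (x y z : 'rV[R]_2).

Lemma similarity_dot (g : 'rV[R]_2 -> 'rV[R]_2) : similarity g ->
  exists2 k : R, 0 < k &
    forall x y z, dot (g x - g z) (g y - g z) = k * dot (x - z) (y - z).
Proof.
move=> [r r0 gr]; exists (r * r); first exact: mulr_gt0.
have sq x y : dot (g x - g y) (g x - g y) = r * r * dot (x - y) (x - y).
  rewrite -!enorm_sqr; have := gr x y; rewrite /dist => ->; ring.
move=> x y z.
have polar (u v w : 'rV[R]_2) : 2 * dot (u - w) (v - w) =
    dot (u - w) (u - w) + dot (v - w) (v - w) - dot (u - v) (u - v).
  by rewrite !dotE !mxE; ring.
have := polar (g x) (g y) (g z); have := polar x y z.
rewrite !sq => h1 h2.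
have : 2 * dot (g x - g z) (g y - g z) = 2 * (r * r * dot (x - z) (y - z)).
  by rewrite h2 mulrCA h1; ring.
by apply: mulfI; rewrite pnatr_eq0.
Qed.

(** A similarity preserves the point dividing a segment in a given ratio, because
    the squared distance between the two candidates expands into scalar
    products that the similarity multiplies by a constant. *)
Lemma similarity_line (g : 'rV[R]_2 -> 'rV[R]_2) x y s : similarity g ->
  g (x + s *: (y - x)) = g x + s *: (g y - g x).
Proof.
move=> /similarity_dot[k k0 gk]; set z := x + _.
apply/eqP; rewrite -subr_eq0 opprD addrA; apply/eqP/dot_eq0.
have e1 := gk z z x; have e2 := gk z y x; have e3 := gk y y x.
have zx : z - x = s *: (y - x) by rewrite /z addrC addKr.
have : dot (g z - g x - s *: (g y - g x)) (g z - g x - s *: (g y - g x)) =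
  dot (g z - g x) (g z - g x) - 2 * s * dot (g z - g x) (g y - g x) +
  s * s * dot (g y - g x) (g y - g x).
  by rewrite !dotE !mxE; ring.
move=> ->; rewrite e1 e2 e3 zx !dotE !mxE; ring.
Qed.

Lemma similarity_robinson g k t : similarity g -> robinson k t ->
  robinson k (map_triangle g t).
Proof.
move=> /similarity_dot[l l0 gl]; case: t => [[A B] C] [q0 eq es] /=.
by split; rewrite !gl ?eq ?es ?pmulr_rgt0// mulrCA.
Qed.

Lemma similarity_children g t : similarity g -> robinson (obtuse t) t ->
  children (map_triangle g t) = [seq map_triangle g u | u <- children t].
Proof.
move=> sg ht; have := robinson_obtuse (similarity_robinson sg ht).
case: t {ht} => [[A B] C]; rewrite /children [map_triangle _ _]/= => ->.
by case: (obtuse _); rewrite /= ?similarity_line.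
Qed.

Lemma similarity_supertile g n t : similarity g -> robinson (obtuse t) t ->
  supertile n (map_triangle g t) = [seq map_triangle g u | u <- supertile n t].
Proof.
move=> sg; elim: n t => [//|n IH] t ht.
rewrite /= similarity_children// map_flatten -!map_comp; congr flatten.
apply/eq_in_map => u ut /=; apply: IH.
by have [] := robinson_children ht ut.
Qed.

Lemma iter_substE n (X : set (triangle R)) u : iter n (@subst R) X u ->
  exists2 t, X t & iter n (@subst R) [set t] u.
Proof.
elim: n u => [|n IH] u; first by exists u.
move=> [t' /IH[t Xt it] h]; exists t => //=.
by exists t'.
Qed.

Lemma subst_children t u : subst [set t] u -> u \in children t.
Proof.
move=> [_ -> []] [ht]; case: t ht => [[A B] C] ht.
  rewrite /children (robinson_obtuse (type0_robinson ht)).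
  by move=> [] -> /=; rewrite !inE eqxx ?orbT.
rewrite /children (robinson_obtuse (type1_robinson ht)).
by move=> [[]|] -> /=; rewrite !inE eqxx ?orbT.
Qed.

Lemma iter_subst_supertile n t u : robinson (obtuse t) t ->
  iter n (@subst R) [set t] u -> u \in supertile n t.
Proof.
elim: n t => [|n IH] t ht; first by move=> ->; rewrite inE.
rewrite iterSr => /iter_substE[v /subst_children vt h].
apply/flatten_mapP; exists v => //; apply: IH => //.
by have [] := robinson_children ht vt.
Qed.

Lemma labelled_robinson t : labelled t -> robinson (obtuse t) t.
Proof.
by move=> [/type0_robinson|/type1_robinson] h; rewrite (robinson_obtuse h).
Qed.

(** A similarity commutes with the substitution, so it can be absorbed into the
    supertile. *)
Lemma finite_patch (P F : set (triangle R)) : penrose_tiling P ->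
  finite_set F -> F `<=` P ->
  exists (t : triangle R) n, robinson (obtuse t) t /\
    forall u, F u -> u \in supertile n t.
Proof.
move=> [_ _ _ _ patch] fF FP.
have [g [t [n [G [sg /labelled_robinson ht Gs FG]]]]] := patch F fF FP.
exists (map_triangle g t), n.
have hg := similarity_robinson sg ht; rewrite (robinson_obtuse hg); split=> //.
move=> u; rewrite FG => -[v Gv <-]; rewrite similarity_supertile//.
by apply/mapP; exists v => //; apply: iter_subst_supertile ht (Gs _ Gv).
Qed.

End Patches.

(** * The area of a triangle *)
Section Area.
Context {R : realType}.
Local Notation leb := (@lebesgue_measure R).
Local Notation leb2 := (leb \x leb)%E.
Implicit Types (E : set (measurableTypeR R * measurableTypeR R)).

Lemma lebesgue_measure_translate (c : R) (A : set (measurableTypeR R)) :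
  measurable A -> leb ((fun y => y + c) @^-1` A) = leb A.
Proof.
move=> mA; have mf : measurable_fun setT (fun y : measurableTypeR R => y + c : measurableTypeR R).
  exact: measurable_funD.
transitivity (pushforward leb (fun y : measurableTypeR R => y + c : measurableTypeR R) A) => //.
apply/esym; apply: (@lebesgue_measure_unique _ (pushforward leb (fun y : measurableTypeR R => y + c : measurableTypeR R))) => // _ [[a b]] _ <-.
rewrite /pushforward [X in _ = leb X](_ : _ = `]a - c, b - c]%classic); last first.
  by apply/seteqP; split=> y /=; rewrite !in_itv /= ltrBlDr lerBrDr.
by rewrite !lebesgue_measure_itv /= !lte_fin ltrD2r -!EFinB; case: ifP => // _; congr _%:E; ring.
Qed.

Definition vshear (s c : R) (p : R * R) : R * R := (p.1, p.2 + (s * p.1 + c)).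
Definition hshear (s c : R) (p : R * R) : R * R := (p.1 + (s * p.2 + c), p.2).

Lemma measure_vshear s c E : measurable E -> leb2 (vshear s c @^-1` E) = leb2 E.
Proof.
move=> mE; apply: eq_integral => x _ /=.
rewrite -(lebesgue_measure_translate (s * x + c) (measurable_xsection x mE)).
by congr (leb _); apply/seteqP; split=> y /=; rewrite !xsectionE.
Qed.

Lemma product_measure12 E : measurable E -> leb2 E = (leb \x^ leb)%E E.
Proof.
by move=> mE; apply: product_measure_unique => //= *; rewrite product_measure2E.
Qed.

Lemma measurable_hshear s c : measurable_fun setT
  (hshear s c : measurableTypeR R * measurableTypeR R -> measurableTypeR R * measurableTypeR R).
Proof.
apply/measurable_fun_pair => //.
apply: measurable_funD => //.
apply: measurable_funD => //.
by apply: measurable_funM.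
Qed.

Lemma measure_hshear s c E : measurable E -> leb2 (hshear s c @^-1` E) = leb2 E.
Proof.
move=> mE; have mE' : measurable (hshear s c @^-1` E).
  by rewrite -[X in measurable X]setTI; apply: measurable_hshear.
rewrite !product_measure12//; apply: eq_integral => y _ /=.
rewrite -(lebesgue_measure_translate (s * y + c) (measurable_ysection y mE)).
by congr (leb _); apply/seteqP; split=> x /=; rewrite !ysectionE.
Qed.

Implicit Types A B C : (R * R)%type.

Definition pdet A B C : R :=
  (B.1 - A.1) * (C.2 - A.2) - (B.2 - A.2) * (C.1 - A.1).

(** The closed triangle if [b] holds, the open one otherwise; both are needed,
    for packing and for covering. *)
Definition tri (b : bool) A B C : set (R * R) :=
  [set p | let be := pdet A p C / pdet A B C in
           let ga := pdet A B p / pdet A B C in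
           [&& 0 < 1 - be - ga ?<= if b, 0 < be ?<= if b
             & 0 < ga ?<= if b]].

Lemma measurable_half_plane (b : bool) (a1 a2 a0 : R) :
  measurable ([set p | 0 < a1 * p.1 + a2 * p.2 + a0 ?<= if b] :
    set (measurableTypeR R * measurableTypeR R)).
Proof.
have mf : measurable_fun setT (fun p : measurableTypeR R * measurableTypeR R =>
    a1 * p.1 + a2 * p.2 + a0 : R).
  by do 2?apply: measurable_funD => //; apply: measurable_funM.
rewrite (_ : [set _ | _] = setT `&` (fun p : measurableTypeR R * measurableTypeR R =>
    a1 * p.1 + a2 * p.2 + a0 : R) @^-1` [set` Interval (BSide b 0) +oo%O]).
  by apply: mf.
rewrite setTI; apply/seteqP; split=> p /=; rewrite !in_itv /= andbT; by case: b.
Qed.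

Lemma measurable_tri b A B C : measurable (tri b A B C : set (measurableTypeR R * measurableTypeR R)).
Proof.
pose b1 := (C.2 - A.2) / pdet A B C; pose b2 := - (C.1 - A.1) / pdet A B C.
pose c1 := - (B.2 - A.2) / pdet A B C; pose c2 := (B.1 - A.1) / pdet A B C.
pose b0 := - b1 * A.1 - b2 * A.2; pose c0 := - c1 * A.1 - c2 * A.2.
rewrite (_ : tri b A B C = [set p | 0 < (- b1 - c1) * p.1 + (- b2 - c2) * p.2 + (1 - b0 - c0) ?<= if b]
   `&` [set p | 0 < b1 * p.1 + b2 * p.2 + b0 ?<= if b]
   `&` [set p | 0 < c1 * p.1 + c2 * p.2 + c0 ?<= if b]).
  by do 2?apply: measurableI; apply: measurable_half_plane.
have eb p : pdet A p C / pdet A B C = b1 * p.1 + b2 * p.2 + b0.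
  by rewrite /b0 /b1 /b2 [pdet A p C]/pdet; ring.
have ec p : pdet A B p / pdet A B C = c1 * p.1 + c2 * p.2 + c0.
  by rewrite /c0 /c1 /c2 [pdet A B p]/pdet; ring.
have ea p : 1 - (b1 * p.1 + b2 * p.2 + b0) - (c1 * p.1 + c2 * p.2 + c0) =
  (- b1 - c1) * p.1 + (- b2 - c2) * p.2 + (1 - b0 - c0) by ring.
apply/seteqP; split=> p; rewrite /tri /= !eb !ec !ea; first by move=> /and3P[-> -> ->].
by move=> [[-> ->] ->].
Qed.

Lemma tri_swap b A B C : tri b A C B = tri b A B C.
Proof.
have sw X Y Z : pdet X Z Y = - pdet X Y Z by rewrite /pdet; ring.
apply/seteqP; split=> p; rewrite /tri /= !(sw A B) (sw A p C) invrN !mulrNN.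
  by move=> /and3P[h1 -> ->]; rewrite addrAC h1.
by move=> /and3P[h1 -> ->]; rewrite addrAC h1.
Qed.

Lemma pdet_vshear s c A B C :
  pdet (vshear s c A) (vshear s c B) (vshear s c C) = pdet A B C.
Proof. by rewrite /pdet /vshear /=; ring. Qed.

Lemma pdet_hshear s c A B C :
  pdet (hshear s c A) (hshear s c B) (hshear s c C) = pdet A B C.
Proof. by rewrite /pdet /hshear /=; ring. Qed.

Lemma tri_vshear s c b A B C :
  leb2 (tri b (vshear s c A) (vshear s c B) (vshear s c C)) = leb2 (tri b A B C).
Proof.
rewrite -(measure_vshear s c (measurable_tri _ _ _ _)); congr leb2.
by apply/seteqP; split=> p; rewrite /tri /= !pdet_vshear.
Qed.

Lemma tri_hshear s c b A B C :
  leb2 (tri b (hshear s c A) (hshear s c B) (hshear s c C)) = leb2 (tri b A B C).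
Proof.
rewrite -(measure_hshear s c (measurable_tri _ _ _ _)); congr leb2.
by apply/seteqP; split=> p; rewrite /tri /= !pdet_hshear.
Qed.

(** The area of the right triangle with legs 1 and [d], by the fundamental
    theorem of calculus. *)
Lemma integral_triangle (d : R) :
  (\int[leb]_(x in `]0%R, 1%R[) (d * (1 - x))%:E = (d / 2)%:E)%E.
Proof.
have cf : continuous (fun x : R => d * (1 - x)).
  by move=> x; apply: cvgM; [exact: cvg_cst|apply: cvgB; [exact: cvg_cst|exact: cvg_id]].
pose F : R -> R := cst d * id - cst (d / 2) * id ^+ 2.
have dF (x : R) : is_derive x (1 : R) F (d * (1 - x)).
  rewrite /F; apply: is_derive_eq.
  rewrite /GRing.scale /= expr1 /cst /=; lra.
have cF : continuous F.
  move=> x; apply/differentiable_continuous/derivable1_diffP.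
  exact: (@ex_derive _ _ _ _ _ _ _ (dF x)).
have FE x : F x = d * x - d / 2 * x ^+ 2 by [].
rewrite -(@integral_itv_bndoo _ 0 1 (fun x => (d * (1 - x))%:E) true false); last first.
  by apply/measurable_EFinP; apply: measurable_funM => //; apply: measurable_funB.
rewrite (@continuous_FTC2 _ _ F 0 1)//.
- rewrite !FE; congr _%:E; lra.
- by apply: continuous_subspaceT.
- split.
  + by move=> x _; exact: (@ex_derive _ _ _ _ _ _ _ (dF x)).
  + exact/cvg_at_right_filter/cF.
  + exact/cvg_at_left_filter/cF.
- by move=> x _; rewrite derive1E derive_val.
Qed.

Lemma base_tri_section b (d x : R) : 0 < d ->
  leb (xsection (tri b (0, 0) (1, 0) (0, d)) x) =
  ((fun x => (d * (1 - x))%:E) \_ [set` Interval (BSide b 0) (BSide (~~ b) 1)]) x.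
Proof.
move=> d0.
have detE : pdet (0, 0) (1, 0) (0, d) = d by rewrite /pdet /=; ring.
have triE y : tri b (0, 0) (1, 0) (0, d) (x, y) =
    [&& 0 < 1 - x - y / d ?<= if b, 0 < x ?<= if b & 0 < y / d ?<= if b].
  rewrite /tri /= detE; have -> : pdet (0, 0) (x, y) (0, d) / d = x.
    by rewrite /pdet /= !subr0 mulr0 subr0 mulfK ?gt_eqF.
  by have -> : pdet (0, 0) (1, 0) (x, y) = y by rewrite /pdet /=; ring.
have edge (z : R) : 0 < 1 - x - z ?<= if b -> 0 < z ?<= if b -> x < 1 ?<= if b.
  by case: (b) => /= h1 h2; lra.
have dV : 0 < d^-1 by rewrite invr_gt0.
rewrite patchE.
case: ifPn => xI.
- have {}xI : (0 < x ?<= if b) && (0 < 1 - x ?<= if b).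
    by move: xI; rewrite inE /= in_itv /= => /andP[-> h]; case: (b) h => /= h; rewrite ?subr_ge0 ?subr_gt0.
  have -> : xsection (tri b (0, 0) (1, 0) (0, d)) x =
      [set` Interval (BSide b 0) (BSide (~~ b) (d * (1 - x)))].
    rewrite xsectionE /preimage; apply: eq_set => y.
    rewrite triE in_itv /=; case/andP: xI => -> _ /=.
    have -> : d * (1 - x) = (1 - x) * d by ring.
    case: (b) => /=.
      by rewrite subr_ge0 (ler_pdivrMr _ _ d0) (pmulr_lge0 _ dV) andbC.
    by rewrite subr_gt0 (ltr_pdivrMr _ _ d0) (pmulr_lgt0 _ dV) andbC.
  rewrite lebesgue_measure_itv /= lte_fin; case: ifPn => [_|].
    by rewrite -EFinB subr0.
  rewrite -leNgt pmulr_rle0// => h; congr _%:E.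
  have -> : 1 - x = 0.
    apply/eqP; rewrite eq_le h; case/andP: xI => _; case: (b) => //=.
    by move=> /ltW.
  by rewrite mulr0.
- have e (y : R) : ~ tri b (0, 0) (1, 0) (0, d) (x, y).
    rewrite triE => /and3P[h1 h2 h3]; case/negP: xI; rewrite inE /= in_itv /= h2 /=.
    by rewrite negbK; exact: edge _ h1 h3.
  have -> : xsection (tri b (0, 0) (1, 0) (0, d)) x = set0; last by rewrite measure0.
  by apply/seteqP; split=> // y; rewrite xsectionE => /e.
Qed.

Lemma area_base_tri b (d : R) : 0 < d ->
  leb2 (tri b (0, 0) (1, 0) (0, d)) = (d / 2)%:E.
Proof.
move=> d0; rewrite -integral_triangle.
rewrite -(@integral_itv_bndoo _ 0 1 (fun x => (d * (1 - x))%:E) b (~~ b)); last first.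
  by apply/measurable_EFinP; apply: measurable_funM => //; apply: measurable_funB.
rewrite [RHS]integral_mkcond; apply: eq_integral => x _.
rewrite /comp base_tri_section//.
Qed.

(** Shears and translations preserve both the area and the determinant, and
    reduce every triangle to one with legs on the coordinate axes. *)
Lemma area_tri b A B C : pdet A B C != 0 ->
  leb2 (tri b A B C) = (`|pdet A B C| / 2)%:E.
Proof.
wlog d0 : B C / 0 < pdet A B C => [hw n0|_].
  have [d0|] := ltP 0 (pdet A B C); first exact: hw.
  have sw : pdet A C B = - pdet A B C by rewrite /pdet; ring.
  rewrite le_eqVlt (negbTE n0) /= => d0.
  by rewrite -tri_swap hw ?sw ?oppr_gt0 ?normrN ?oppr_eq0.
rewrite gtr0_norm//.
(* The normalisations: [A] at the origin, [B] off the first axis so that a shear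
   can bring its abscissa to 1, then [B] on the first axis and [C] on the
   second; [C] then has ordinate the determinant. *)
wlog A0 : A B C d0 / A = (0, 0).
  move=> hw.
  rewrite -(pdet_vshear 0 (- A.2)) -(tri_vshear 0 (- A.2)).
  rewrite -(pdet_hshear 0 (- A.1)) -(tri_hshear 0 (- A.1)).
  apply: hw; first by rewrite pdet_hshear pdet_vshear.
  by rewrite /hshear /vshear /=; congr (_, _); ring.
subst A.
have vs0 s : vshear s 0 (0, 0) = (0, 0).
  by rewrite /vshear /=; congr (_, _); ring.
have hs0 s : hshear s 0 (0, 0) = (0, 0).
  by rewrite /hshear /=; congr (_, _); ring.
wlog B2 : B C d0 / B.2 != 0.
  move=> hw; have [B2|] := eqVneq B.2 0; last exact: hw.
  have B1 : B.1 != 0.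
    by apply/negP => /eqP B1; move: d0; rewrite /pdet B2 B1 /= !subr0 !mul0r subr0 ltxx.
  have := pdet_vshear 1 0 (0, 0) B C; have := tri_vshear 1 0 b (0, 0) B C.
  rewrite vs0 => <- <-; apply: hw; last by rewrite /= B2 add0r mul1r addr0.
  by rewrite -(vs0 1) pdet_vshear.
wlog B1 : B C d0 B2 / B.1 = 1.
  move=> hw; pose s := (1 - B.1) / B.2.
  have := pdet_hshear s 0 (0, 0) B C; have := tri_hshear s 0 b (0, 0) B C.
  rewrite hs0 => <- <-; apply: hw => //; last by rewrite /= /s; field.
  by rewrite -(hs0 s) pdet_hshear.
wlog {B2} B2 : B C d0 B1 {B2} / B.2 = 0.
  move=> hw; pose s := - B.2.
  have := pdet_vshear s 0 (0, 0) B C; have := tri_vshear s 0 b (0, 0) B C.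
  rewrite vs0 => <- <-; apply: hw => //; last by rewrite /= B1 /s; ring.
  by rewrite -(vs0 s) pdet_vshear.
have C2 : C.2 = pdet (0, 0) B C by rewrite /pdet B1 B2 /=; ring.
wlog C1 : C d0 C2 / C.1 = 0.
  move=> hw; pose s := - C.1 / C.2.
  have n0 : C.2 != 0 by rewrite C2 gt_eqF.
  have eB : hshear s 0 B = B.
    by rewrite /hshear B2 mulr0 !addr0 -B2 -surjective_pairing.
  have e1 := pdet_hshear s 0 (0, 0) B C; have e2 := tri_hshear s 0 b (0, 0) B C.
  rewrite -e1 -e2; move: e1; rewrite hs0 eB => e1.
  by apply: hw; rewrite ?e1//= /s; field.
rewrite -C2; have {}d0 : 0 < C.2 by rewrite C2.
have -> : B = (1, 0) by rewrite -B1 -B2 -surjective_pairing.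
by rewrite {1}(surjective_pairing C) C1 area_base_tri.
Qed.

End Area.

From mathcomp Require Import finmap.

(** * Tiles against square cells *)
Section Cells.
Context {R : realType}.
Local Notation phi := (golden R).
Local Notation leb := (@lebesgue_measure R).
Local Notation leb2 := (leb \x leb)%E.

Lemma measure_cover d (T : measurableType d) (mu : {measure set T -> \bar R})
    (I J : choiceType) (F : {fset I}) (G : {fset J}) (A : I -> set T)
    (B : J -> set T) :
  (forall i, i \in F -> measurable (A i)) ->
  (forall j, j \in G -> measurable (B j)) ->
  trivIset [set` F] A ->
  (forall i x, i \in F -> A i x -> exists2 j, j \in G & B j x) ->
  (\sum_(i <- F) mu (A i) <= \sum_(j <- G) mu (B j))%E.
Proof.
move=> mA mB tA AB; rewrite -measure_fbigsetU//.
have mUA : measurable (\big[setU/set0]_(i <- F) A i).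
  by rewrite big_seq; apply: bigsetU_measurable.
have mUB (s : seq J) : {subset s <= G} -> measurable (\big[setU/set0]_(j <- s) B j).
  by move=> sG; rewrite big_seq; apply: bigsetU_measurable => j /sG; exact: mB.
apply: (@le_trans _ _ (mu (\big[setU/set0]_(j <- G) B j))).
  apply: le_measure; [exact/mem_set|exact/mem_set/mUB|].
  move=> x; rewrite -!bigcup_fset => -[i iF Aix].
  by have [j jG Bjx] := AB i x iF Aix; exists j.
have : {subset (G : seq J) <= G} by [].
elim: (X in {subset X <= _} -> (mu (\big[_/_]_(_ <- X) _) <= \sum_(_ <- X) _)%E)
    => [|j s IH] sG; first by rewrite !big_nil measure0.
rewrite !big_cons; have sG' : {subset s <= G} by move=> k ks; apply: sG; rewrite inE ks orbT.
apply: le_trans (leeD2l _ (IH sG')); apply: measureU2; last exact: mUB.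
by apply: mB; apply: sG; exact: mem_head.
Qed.

Definition planar (x : 'rV[R]_2) : R * R := (x 0 0, x 0 1).
Definition point_of (p : R * R) : 'rV[R]_2 := \row_i (if i == 0 then p.1 else p.2).

Lemma point_ofK : cancel point_of planar.
Proof. by move=> [a b]; rewrite /planar !mxE. Qed.

Definition tile_set (b : bool) (t : triangle R) : set (R * R) :=
  let: (A, B, C) := t in tri b (planar A) (planar B) (planar C).

Lemma tile_setE b t x : tile_set b t (planar x) =
  (if b then within (pos t x) else inside (pos t x)).
Proof.
case: t => [[A B] C]; rewrite /tile_set /tri /= /pos /= /cross !mxE /pdet /=.
by case: b.
Qed.

(** Half-open cells, so that they partition the plane. *)
Definition cell (h : R) (c : int * int) : set (R * R) :=
  `[h * c.1%:~R, h * (c.1 + 1)%:~R[ `*` `[h * c.2%:~R, h * (c.2 + 1)%:~R[.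

Lemma measurable_cell h c :
  measurable (cell h c : set (measurableTypeR R * measurableTypeR R)).
Proof. by apply: measurableX. Qed.

Lemma area_cell h c : 0 < h -> leb2 (cell h c) = (h * h)%:E.
Proof.
move=> h0; rewrite /cell.
have side (i : int) : leb (`[h * i%:~R, h * (i + 1)%:~R[%classic : set R) = h%:E.
  rewrite lebesgue_measure_itv /= lte_fin intrD mulrDr mulr1 ltrDl h0 -EFinB.
  by congr _%:E; ring.
by rewrite product_measure1E ?side//= EFinM !side.
Qed.

Lemma cell_floor (h : R) (x : 'rV[R]_2) : 0 < h ->
  cell h (Num.floor (x 0 0 / h), Num.floor (x 0 1 / h)) (planar x).
Proof.
move=> h0; split; rewrite /= in_itv /=.
  by have := floor_itv (x 0 0 / h); rewrite ler_pdivlMr// ltr_pdivrMr// !(mulrC h).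
by have := floor_itv (x 0 1 / h); rewrite ler_pdivlMr// ltr_pdivrMr// !(mulrC h).
Qed.

Lemma cell_disjoint (h : R) c c' p : 0 < h -> cell h c p -> cell h c' p -> c = c'.
Proof.
move=> h0; case: c c' => [i j] [i' j'] [/= + +] [/= + +].
have coord (k k' : int) (a : R) : a \in `[h * k%:~R, h * (k + 1)%:~R[ ->
    a \in `[h * k'%:~R, h * (k' + 1)%:~R[ -> k = k'.
  rewrite !in_itv /= => /andP[h1 h2] /andP[h3 h4].
  have := le_lt_trans h1 h4; have := le_lt_trans h3 h2.
  by rewrite !ltr_pM2l// !ltr_int !ltzD1 => ? ?; apply/eqP; rewrite eq_le; apply/andP.
by move=> h1 h2 h3 h4; rewrite (coord _ _ _ h1 h3) (coord _ _ _ h2 h4).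
Qed.

Definition tile_area (t : triangle R) : R := `|tri_det t| / 2.

Lemma measure_tile_set b t : tri_det t != 0 ->
  leb2 (tile_set b t) = (tile_area t)%:E.
Proof.
case: t => [[A B] C] d0; have e : pdet (planar A) (planar B) (planar C) = tri_det (A, B, C).
  by rewrite /pdet /= /cross !mxE.
by rewrite /tile_set area_tri ?e.
Qed.

Lemma measurable_tile_set b t :
  measurable (tile_set b t : set (measurableTypeR R * measurableTypeR R)).
Proof. by case: t => [[A B] C]; apply: measurable_tri. Qed.

Lemma sum_area_cell (h : R) (G : {fset int * int}) : 0 < h ->
  (\sum_(c <- G) leb2 (cell h c))%E = (h * h * #|` G|%:R)%:E.
Proof.
move=> h0; transitivity (\sum_(c <- G) (h * h)%:E)%E.
  by apply: eq_bigr => c _; exact: area_cell.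
by rewrite sumEFin big_const_seq count_predT iter_addr_0 mulr_natr.
Qed.

Lemma sum_measure_tile_set b (F : {fset triangle R}) :
  (forall t, t \in F -> tri_det t != 0) ->
  (\sum_(t <- F) leb2 (tile_set b t))%E = (\sum_(t <- F) tile_area t)%:E.
Proof.
move=> d0; rewrite -sumEFin big_seq [RHS]big_seq; apply: eq_bigr => t tF.
exact: measure_tile_set (d0 t tF).
Qed.

Lemma tiles_in_cells (h : R) (F : {fset triangle R}) (G : {fset int * int}) :
  0 < h -> (forall t, t \in F -> tri_det t != 0) ->
  (forall t u x, t \in F -> u \in F -> inside (pos t x) -> inside (pos u x) -> t = u) ->
  (forall t x, t \in F -> inside (pos t x) -> exists2 c, c \in G & cell h c (planar x)) ->
  \sum_(t <- F) tile_area t <= h * h * #|` G|%:R.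
Proof.
move=> h0 d0 dis cov.
have : (\sum_(t <- F) leb2 (tile_set false t) <= \sum_(c <- G) leb2 (cell h c))%E.
  apply: measure_cover => //.
  - by move=> *; apply: measurable_tile_set.
  - by move=> *; apply: measurable_cell.
  - move=> t u /= tF uF [p]; rewrite -[p]point_ofK => -[].
    by rewrite !tile_setE => ? ?; apply: (dis t u (point_of p)).
  - by move=> t p tF; rewrite -[p]point_ofK tile_setE; apply: cov.
by rewrite sum_area_cell// sum_measure_tile_set// lee_fin.
Qed.

Lemma cells_in_tiles (h : R) (F : {fset triangle R}) (G : {fset int * int}) :
  0 < h -> (forall t, t \in F -> tri_det t != 0) ->
  (forall c x, c \in G -> cell h c (planar x) -> exists2 t, t \in F & within (pos t x)) ->
  h * h * #|` G|%:R <= \sum_(t <- F) tile_area t.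
Proof.
move=> h0 d0 cov.
have : (\sum_(c <- G) leb2 (cell h c) <= \sum_(t <- F) leb2 (tile_set true t))%E.
  apply: measure_cover => //.
  - by move=> *; apply: measurable_cell.
  - by move=> *; apply: measurable_tile_set.
  - by move=> c c' /= _ _ [p [cp cp']]; apply: (cell_disjoint h0 cp cp').
  - move=> c p cG; rewrite -[p]point_ofK => /(cov _ _ cG)[t tF tp].
    by exists t => //; rewrite tile_setE.
by rewrite sum_area_cell// sum_measure_tile_set// lee_fin.
Qed.

(** Ratio between area and weight of a tile of squared leg length 1. *)
Definition unit_area : R := Num.sqrt (3 - phi) / 4 * 5 / (phi + 2).

Lemma unit_area_gt0 : 0 < unit_area.
Proof.
have h1 := @golden_gt R; have h2 := @golden_lt R.
by rewrite /unit_area !mulr_gt0 ?invr_gt0 ?sqrtr_gt0//; lra.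
Qed.

(** Both types have the same ratio because [(phi + 2) = phi ^+ 2 * (3 - phi)]:
    the area of type 1 is [phi] times that of type 0. *)
Lemma tile_areaE t : robinson (obtuse t) t ->
  tile_area t = unit_area * leg_sqr t * area_weight t.
Proof.
move=> ht; have h1 := @golden_gt R; have h2 := @golden_lt R.
have q0 : 0 <= leg_sqr t by case: (t) => [[A B] C]; apply: dot_ge0.
rewrite /tile_area -sqrtr_sqr (robinson_det ht) sqrtrM; last by case: ifP => _; lra.
rewrite sqrtr_sqr (ger0_norm q0) /unit_area /area_weight.
have s4 : Num.sqrt (4^-1) = 2^-1 :> R.
  by rewrite (_ : 4^-1 = 2^-1 ^+ 2 :> R) ?sqrtr_sqr ?ger0_norm//; lra.
have -> : Num.sqrt (if obtuse t then (phi + 2) / 4 else (3 - phi) / 4) =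
    (if obtuse t then phi else 1) * Num.sqrt (3 - phi) / 2.
  case: ifP => _; last by rewrite mul1r sqrtrM ?s4//; lra.
  have -> : (phi + 2) / 4 = phi ^+ 2 * ((3 - phi) / 4).
    by apply: (@golden_eq _ ((phi - 2) / 4)); ring.
  rewrite sqrtrM ?sqr_ge0// sqrtr_sqr ger0_norm; last lra.
  by rewrite sqrtrM ?s4 ?mulrA//; lra.
have -> : (if obtuse t then (3 * phi + 1) / 5 else (phi + 2) / 5) =
    (if obtuse t then phi else 1) * ((phi + 2) / 5).
  by case: ifP => _; rewrite ?mul1r//; apply: (@golden_eq _ (- 1 / 5)); ring.
by field; apply: lt0r_neq0; lra.
Qed.

End Cells.

(** * Distances between tiles, corners and cells *)
Section Tiling.
Context {R : realType}.
Local Notation phi := (golden R).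
Implicit Types (t u v : triangle R) (x y : 'rV[R]_2).

Lemma enorm_leg t l : 0 < l -> leg_sqr t = l * l -> robinson (obtuse t) t ->
  let: (A, B, C) := t in enorm (B - A) = l /\ enorm (C - A) = l.
Proof.
case: t => [[A B] C] l0 /= ql [_ eq _].
by rewrite /enorm eq ql -expr2 sqrtr_sqr gtr0_norm.
Qed.

Lemma within_corner_dist t x c l : 0 < l -> leg_sqr t = l * l ->
  robinson (obtuse t) t -> within (pos t x) -> c \in corners t ->
  enorm (x - c) <= 2 * l.
Proof.
move=> l0 ql ht; have d0 := robinson_det_neq0 ht.
have := enorm_leg l0 ql ht; case: t ql ht d0 => [[A B] C] _ _ d0 [lB lC].
case E: (coords (A, B, C) x) => [[a b] c'].
rewrite /pos E => /and3P[a0 b0 c0].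
have s1 := coords_sum E; have xE := coords_comb d0 E.
have xA : enorm (x - A) <= l.
  have -> : x - A = b *: (B - A) + c' *: (C - A).
    have -> : b *: (B - A) + c' *: (C - A) = x - (a + b + c') *: A.
      by rewrite xE; apply: row2P; rewrite !mxE; ring.
    by rewrite s1 scale1r.
  apply: le_trans (enormD _ _) _; rewrite !enormZ lB lC !ger0_norm//; nra.
rewrite !inE => /or3P[] /eqP->.
- lra.
- by have := dist_triangle x A B; rewrite (enormB A B) lB; lra.
- by have := dist_triangle x A C; rewrite (enormB A C) lC; lra.
Qed.

Lemma within_corner t c : tri_det t != 0 -> c \in corners t -> within (pos t c).
Proof.
case: t => [[A B] C] d0; have [eA eB eC] := coords_corners d0.
rewrite /pos !inE => /or3P[] /eqP->; rewrite ?eA ?eB ?eC /=;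
  by rewrite !lexx ler01.
Qed.

Lemma coord_le_enorm x (i : 'I_2) : `|x 0 i| <= enorm x.
Proof.
rewrite -(ger0_norm (enorm_ge0 x)) -ler_sqr ?nnegrE// !real_normK ?num_real//.
rewrite [leRHS]expr2 enorm_sqr dotE -!expr2.
have [->|->] : i = 0 \/ i = 1.
  by case: i => [[|[|//]] hi]; [left|right]; apply: val_inj.
- by rewrite lerDl sqr_ge0.
- by rewrite lerDr sqr_ge0.
Qed.

Lemma mem_int_range (K : nat) (k : int) : - K%:Z < k -> k < K%:Z ->
  k \in [seq i%:Z - K%:Z | i <- iota 0 (2 * K).+1].
Proof.
move=> h1 h2; apply/mapP; exists (absz (k + K%:Z)); last by lia.
by rewrite mem_iota; lia.
Qed.

Lemma bounded_cells (h r : R) x0 : 0 < h -> exists G : {fset int * int},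
  forall x c, enorm (x - x0) <= r -> cell h c (planar x) -> c \in G.
Proof.
move=> h0; pose M := (r + `|x0 0 0| + `|x0 0 1|) / h + 1.
pose K := Num.bound `|M|.
pose I := [seq i%:Z - K%:Z | i <- iota 0 (2 * K).+1].
exists (seq_fset tt [seq (a, b) | a <- I, b <- I]) => x [a b] xr [ca cb].
have bnd (i : 'I_2) (k : int) : `|x0 0 i| <= `|x0 0 0| + `|x0 0 1| ->
    x 0 i \in `[h * k%:~R, h * (k + 1)%:~R[ -> k \in I.
  move=> xi; rewrite in_itv /= => /andP[k1 k2].
  have := coord_le_enorm (x - x0) i; rewrite !mxE => /le_trans /(_ xr) xx.
  have xa : `|x 0 i| <= (M - 1) * h.
    rewrite /M addrK divfK ?gt_eqF//.
    by have := ler_normD (x 0 i - x0 0 i) (x0 0 i); rewrite subrK; lra.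
  move: xa; rewrite ler_norml => /andP[xl xu].
  have MK : M < K%:R by exact: le_lt_trans (ler_norm M) (archi_boundP (normr_ge0 M)).
  have kM : k%:~R <= M - 1.
    by rewrite -(ler_pM2l h0) (mulrC h (M - 1)); exact: le_trans xu.
  have kN : - M < k%:~R.
    suff : - (M - 1) < (k + 1)%:~R by rewrite intrD; lra.
    by rewrite -(ltr_pM2l h0) mulrN (mulrC h (M - 1)); exact: le_lt_trans k2.
  have {kM} kK : (k < K%:Z)%R by rewrite -(@ltr_int R) -pmulrn; lra.
  have {kN} Kk : (- K%:Z < k)%R by rewrite -(@ltr_int R) rmorphN /= -pmulrn; lra.
  exact: mem_int_range.
rewrite seq_fsetE; apply/allpairsPdep; exists a, b; split=> //.
- by apply: (bnd 0) => //; rewrite lerDl.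
- by apply: (bnd 1) => //; rewrite lerDr.
Qed.

End Tiling.

(** * Infinite locally finite matchings *)
Section Marriage.
Local Open Scope fset_scope.
Context {X Y : choiceType}.
Implicit Types (N : X -> {fset Y}) (A B : {fset X}) (D : set (X * Y)).

Definition neighbours N A : {fset Y} := \bigcup_(a <- A) N a.

Lemma neighboursP N A y :
  reflect (exists2 a, a \in A & y \in N a) (y \in neighbours N A).
Proof.
apply: (iffP (bigfcupP _ _ _ _)) => [[a]|[a aA ya]].
  by rewrite andbT => aA ya; exists a.
by exists a; rewrite ?andbT.
Qed.

Definition hall (P : set X) N :=
  forall A, {subset A <= P} -> (#|` A| <= #|` neighbours N A|)%N.

(** The graph from which the edges of [D] have been removed. *)
Definition prune N D (x : X) : {fset Y} := [fset y in N x | (x, y) \notin D].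

Lemma mem_prune N D x y : (y \in prune N D x) = (y \in N x) && ((x, y) \notin D).
Proof. by rewrite !inE. Qed.

Lemma eq_neighbours N N' A : (forall a, a \in A -> N a = N' a) ->
  neighbours N A = neighbours N' A.
Proof.
move=> e; apply/fsetP => y; apply/neighboursP/neighboursP => -[a aA ya];
  by exists a => //; rewrite ?e // -e.
Qed.

(** Hall's condition on a finite set only involves finitely many edges, so along
    a chain it is already decided by one member. *)
Lemma hall_chain (P : set X) N (F : set (set (X * Y))) : hall P N ->
  (F `<=` [set D | hall P (prune N D)])%classic -> total_on F subset ->
  hall P (prune N (\bigcup_(D in F) D)%classic).
Proof.
move=> hN FP tF A AP.
have [[D0 FD0]|F0] := pselect (exists D, F D); last first.
  rewrite (@eq_neighbours _ N) ?hN// => a aA; apply/fsetP => y.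
  rewrite mem_prune andb_idr// => _; apply/negP; rewrite in_setE => -[D FD _].
  by apply: F0; exists D.
have [D FD DA] : exists2 D, F D & forall e, e \in [seq (x, y) | x <- A, y <- N x] ->
    (\bigcup_(D in F) D)%classic e -> D e.
  elim: [seq _ | _ <- _, _ <- _] => [|e s [D FD Ds]]; first by exists D0.
  have [[D' FD' D'e]|ne] := pselect ((\bigcup_(D in F) D)%classic e); last first.
    exists D => // e'; rewrite inE => /orP[/eqP->//|]; exact: Ds.
  have [DD'|D'D] := tF _ _ FD FD'.
    exists D' => // e'; rewrite inE => /orP[/eqP->//|e's] Ue'.
    by apply: DD'; apply: Ds.
  exists D => // e'; rewrite inE => /orP[/eqP-> _|]; [exact: D'D|exact: Ds].
rewrite (@eq_neighbours _ (prune N D)); first exact: (FP _ FD).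
move=> a aA; apply/fsetP => y; rewrite !mem_prune.
have [ya|//] := boolP (y \in N a); congr (~~ _); apply/idP/idP; rewrite !in_setE.
  by apply: DA; apply/allpairsPdep; exists a, y.
by move=> De; exists D.
Qed.

(** If two different edges at [x] were both needed, each would be needed by a
    tight set; the union and the intersection of these sets violate Hall's
    condition, because counting neighbours is submodular. *)
Lemma hall_submodular (P : set X) N x y1 y2 : hall P N ->
  y1 != y2 -> P x ->
  (forall y, y \in [:: y1; y2] -> exists B, [/\ {subset B <= P}, x \notin B &
     (#|` neighbours N B `|` (N x `\ y)| <= #|` B|)%N]) -> False.
Proof.
move=> hN n12 Px H.
have [B1 [B1P xB1 c1]] := H y1 (mem_head _ _).
have [B2 [B2P xB2 c2]] : exists B, [/\ {subset B <= P}, x \notin B &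
     (#|` neighbours N B `|` (N x `\ y2)| <= #|` B|)%N].
  by apply: H; rewrite !inE eqxx orbT.
set U1 := neighbours N B1 `|` _ in c1; set U2 := neighbours N B2 `|` _ in c2.
have hU : (#|` x |` (B1 `|` B2)| <= #|` U1 `|` U2|)%N.
  apply: (@leq_trans #|` neighbours N (x |` (B1 `|` B2))|).
    by apply: hN => z; rewrite !inE => /orP[/eqP->|/orP[/B1P|/B2P]//]; rewrite ?in_setE.
  apply: fsubset_leq_card; apply/fsubsetP => y /neighboursP[a].
  rewrite !inE => /orP[/eqP->|/orP[aB|aB]] ya.
  - rewrite ya andbT; have [->|n] := eqVneq y y1.
      by rewrite n12 !orbT.
    by rewrite /= orbT.
  - by apply/orP; left; apply/orP; left; apply/neighboursP; exists a.
  - by apply/orP; right; apply/orP; left; apply/neighboursP; exists a.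
have hI : (#|` B1 `&` B2| <= #|` U1 `&` U2|)%N.
  apply: (@leq_trans #|` neighbours N (B1 `&` B2)|).
    by apply: hN => z; rewrite !inE => /andP[/B1P].
  apply: fsubset_leq_card; apply/fsubsetP => y /neighboursP[a].
  rewrite !inE => /andP[aB1 aB2] ya.
  apply/andP; split; apply/orP; left; apply/neighboursP; by exists a.
have := cardfsUI U1 U2; have := cardfsUI B1 B2.
move: hU; rewrite cardfsU1 !inE (negbTE xB1) (negbTE xB2) /=.
by move: c1 c2 hI; lia.
Qed.

(** Rado's proof of the marriage theorem: remove a maximal set of edges keeping
    Hall's condition; exactly one edge is left at each vertex of [P]. *)
Lemma hall_matching (y0 : Y) (P : set X) N : hall P N ->
  exists f : X -> Y, (forall x, P x -> f x \in N x) /\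
    (forall x x', P x -> P x' -> f x = f x' -> x = x').
Proof.
move=> hN.
have [D [hD maxD]] := @Zorn_bigcup _ [set D | hall P (prune N D)]
  (fun F FP tF => hall_chain hN FP tF).
pose M := prune N D.
have ne x : P x -> (0 < #|` M x|)%N.
  move=> Px; have := hD [fset x]; rewrite cardfs1.
  have -> : neighbours (prune N D) [fset x] = M x.
    by rewrite /neighbours big_seq_fset1.
  by apply=> z; rewrite inE => /eqP->; rewrite in_setE.
have one x y1 y2 : P x -> y1 \in M x -> y2 \in M x -> y1 = y2.
  move=> Px y1M y2M; apply/eqP/negPn/negP => n12.
  apply: (hall_submodular hD n12 Px) => y yy.
  have yM : y \in M x by move: yy; rewrite !in_cons in_nil orbF => /orP[] /eqP->.
  pose D' := (D `|` [set (x, y)])%classic.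
  have : ~ hall P (prune N D').
    apply: maxD; split; first by move=> e; left.
    move=> /(_ (x, y)) h; move: yM; rewrite mem_prune => /andP[_ /negP]; apply.
    by rewrite in_setE; apply: h; right.
  move=> /existsNP[A /not_implyP[AP /negP]]; rewrite -ltnNge => cA.
  have M' z : prune N D' z = if z == x then M x `\ y else M z.
    apply/fsetP => w; rewrite mem_prune; case: eqVneq => [->|zx].
      rewrite !inE andbCA; congr (_ && _).
      rewrite -negb_or orbC; congr (~~ _); apply/idP/orP; rewrite !in_setE.
        by move=> [h|[->]]; [left|right].
      by move=> [?|/eqP->]; [left|right].
    rewrite mem_prune; congr (_ && ~~ _); apply/idP/idP; rewrite !in_setE; last by left.
    by move=> [//|[zx' _]]; rewrite zx' eqxx in zx.
  have xA : x \in A.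
    apply/negPn/negP => xA; move: cA; apply/negP; rewrite -leqNgt.
    rewrite (@eq_neighbours _ M); first exact: hD.
    by move=> a aA; rewrite M'; case: eqVneq => // e; rewrite -e aA in xA.
  exists (A `\ x); split.
  - by move=> z; rewrite !inE => /andP[_ /AP].
  - by rewrite !inE eqxx.
  - have : neighbours M (A `\ x) `|` (M x `\ y) `<=` neighbours (prune N D') A.
      apply/fsubsetP => w; rewrite in_fsetU => /orP[/neighboursP[a]|].
        rewrite in_fsetD1 => /andP[ax aA] wa; apply/neighboursP; exists a => //.
        by rewrite M' (negbTE ax).
      by move=> wx; apply/neighboursP; exists x => //; rewrite M' eqxx.
    move=> /fsubset_leq_card h; have := leq_ltn_trans h cA.
    by rewrite (cardfsD1 x A) xA add1n ltnS.
pose f x := head y0 (M x).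
have fM x : P x -> f x \in M x.
  move=> /ne; rewrite /f; case E: (enum_fset (M x)) => [|y s].
    by [].
  by move=> _; rewrite -[_ \in M x]/(_ \in enum_fset (M x)) E mem_head.
exists f; split=> [x /fM|x x' Px Px' fxx']; first by rewrite mem_prune => /andP[].
apply/eqP/negPn/negP => xx'.
have sub : neighbours M [fset x; x'] `<=` [fset f x].
  apply/fsubsetP => y /neighboursP[a]; rewrite !in_fset2 in_fset1.
  move=> /orP[] /eqP-> ya; apply/eqP.
    by apply: (one x) => //; exact: fM.
  by rewrite fxx'; apply: (one x') => //; exact: fM.
have AP : {subset [fset x; x'] <= P}.
  by move=> z; rewrite in_fset2 => /orP[] /eqP->; rewrite in_setE.
have := leq_trans (hD _ AP) (fsubset_leq_card sub).
by rewrite cardfs2 xx' cardfs1.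
Qed.

End Marriage.

(** The Cantor-Bernstein bijection sends [x] to [f x] or to a preimage of [x]
    under [g], so it stays inside any relation containing both graphs. *)
Lemma bernstein_relation (X : Type) (Y : choiceType) (P : set X) (Q : set Y)
    (E : X -> Y -> Prop) (f : X -> Y) (g : Y -> X) :
  (forall x, P x -> Q (f x) /\ E x (f x)) -> set_inj P f ->
  (forall y, Q y -> P (g y) /\ E (g y) y) -> set_inj Q g ->
  exists h : X -> Y, set_bij P Q h /\ forall x, P x -> E x (h x).
Proof.
move=> fE fI gE gI.
pose S x := exists n x0, [/\ P x0, ~ (exists2 y, Q y & g y = x0) &
  x = iter n (g \o f) x0].
have itP n x0 : P x0 -> P (iter n (g \o f) x0).
  by move=> Px0; elim: n => //= n /fE[/gE[]].
have SP x : S x -> P x by move=> [n [x0 [Px0 _ ->]]]; exact: itP.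
have Sgf x : S x -> S (g (f x)).
  by move=> [n [x0 [Px0 nx0 ->]]]; exists n.+1, x0.
have nS x : P x -> ~ S x -> exists y, Q y /\ g y = x.
  move=> Px nSx; have [[y Qy gy]|ny] := pselect (exists2 y, Q y & g y = x).
    by exists y.
  by case: nSx; exists 0%N, x.
pose h x := if pselect (S x) then f x else xget (f x) [set y | Q y /\ g y = x].
have hS x : S x -> h x = f x by move=> Sx; rewrite /h; case: pselect => // Sx'; case: Sx'.
have hN x : P x -> ~ S x -> Q (h x) /\ g (h x) = x.
  move=> Px nSx; rewrite /h; case: pselect => [//|nSx1].
  have [y Qy] := nS x Px nSx.
  by apply: (@xgetPex _ (f x) [set y | Q y /\ g y = x]); exists y.
exists h; split; last first.
  move=> x Px; have [Sx|nSx] := pselect (S x); first by rewrite hS//; case: (fE x Px).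
  by have [Qh ghx] := hN x Px nSx; have [_] := gE _ Qh; rewrite ghx.
split.
- move=> x Px; have [Sx|nSx] := pselect (S x); first by rewrite hS//; case: (fE x Px).
  by have [] := hN x Px nSx.
- have cross x x' : P x -> P x' -> S x -> ~ S x' -> h x = h x' -> False.
    move=> Px Px' Sx nSx'; rewrite hS// => e; apply: (nSx').
    by have [_ <-] := hN x' Px' nSx'; rewrite -e; exact: Sgf.
  move=> x x' /set_mem Px /set_mem Px' e.
  have [Sx|nSx] := pselect (S x); have [Sx'|nSx'] := pselect (S x').
  + by move: e; rewrite !hS// => e; apply: fI => //; exact: mem_set.
  + by case: (cross x x').
  + by case: (cross x' x).
  + have [_ <-] := hN x Px nSx; have [_ <-] := hN x' Px' nSx'.
    by rewrite e.
- move=> y Qy; have [Pg _] := gE y Qy.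
  have [[n [x0 [Px0 nx0]]]|nSg] := pselect (S (g y)).
    case: n => [/= gy|n /= gy]; first by case: nx0; exists y.
    exists (iter n (g \o f) x0); first exact: itP.
    have Sx : S (iter n (g \o f) x0) by exists n, x0.
    rewrite hS//; apply: gI; rewrite ?in_setE//.
    by case: (fE _ (itP n _ Px0)).
  exists (g y) => //; have [Qh gh] := hN _ Pg nSg.
  by apply: gI => //; exact: mem_set.
Qed.

(** * Counting in a tiling *)
Section TilingFacts.
Context {R : realType}.
Local Notation phi := (golden R).
Implicit Types (t u v : triangle R) (x y : 'rV[R]_2).

Lemma inside_interior t x : tri_det t != 0 -> inside (pos t x) ->
  interior (region t) x.
Proof.
move=> d0; rewrite /interior /= => ix.
have cont (i : 'I_2) : {for x, continuous (fun y : 'rV[R]_2 => y 0 i)}.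
  exact: coord_continuous.
case: t d0 ix => [[A B] C] d0 /and3P[a0 b0 c0].
have aff (u w : R) (e : R) : {for x, continuous (fun y : 'rV[R]_2 => u * y 0 0 + w * y 0 1 + e)}.
  pose k (a : R) : {for x, continuous (fun=> a : R)} := @cst_continuous _ _ a x.
  exact: (continuousD (continuousD (continuousM (k u) (cont 0))
    (continuousM (k w) (cont 1))) (k e)).
have pos_near (f : 'rV[R]_2 -> R) (u w e : R) :
    (forall y, f y = u * y 0 0 + w * y 0 1 + e) -> 0 < f x -> \forall y \near x, 0 < f y.
  move=> fE; have -> : f = (fun y => u * y 0 0 + w * y 0 1 + e) by apply/funext.
  by move=> f0; have /cvgr_gt := aff u w e; apply.
set d := tri_det (A, B, C) in d0.
have nb : \forall y \near x, 0 < cross (y - A) (C - A) / d.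
  apply: (@pos_near _ ((C 0 1 - A 0 1) / d) (- (C 0 0 - A 0 0) / d)
    ((- A 0 0 * (C 0 1 - A 0 1) + A 0 1 * (C 0 0 - A 0 0)) / d)) => //.
  by move=> y; rewrite /cross !mxE; ring.
have nc : \forall y \near x, 0 < cross (B - A) (y - A) / d.
  apply: (@pos_near _ (- (B 0 1 - A 0 1) / d) ((B 0 0 - A 0 0) / d)
    ((- A 0 1 * (B 0 0 - A 0 0) + A 0 0 * (B 0 1 - A 0 1)) / d)) => //.
  by move=> y; rewrite /cross !mxE; ring.
have na : \forall y \near x, 0 < 1 - cross (y - A) (C - A) / d - cross (B - A) (y - A) / d.
  apply: (@pos_near _ (- ((C 0 1 - A 0 1) / d) - (- (B 0 1 - A 0 1) / d))
     (- (- (C 0 0 - A 0 0) / d) - (B 0 0 - A 0 0) / d)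
    (1 - ((- A 0 0 * (C 0 1 - A 0 1) + A 0 1 * (C 0 0 - A 0 0)) / d) -
    ((- A 0 1 * (B 0 0 - A 0 0) + A 0 0 * (B 0 1 - A 0 1)) / d))) => //.
  by move=> y; rewrite /cross !mxE; ring.
suff : \forall y \near x, region (A, B, C) y by [].
near=> y; apply/regionE => //; apply/and3P; split; apply: ltW; by near: y.
Unshelve. all: by end_near.
Qed.

Variables (P : set (triangle R)) (hP : penrose_tiling P).

Lemma tiling_robinson t : P t -> robinson (obtuse t) t.
Proof. by case: hP => lab _ _ _ _ /lab /labelled_robinson. Qed.

Lemma tiling_det t : P t -> tri_det t != 0.
Proof. by move=> /tiling_robinson /robinson_det_neq0. Qed.

Lemma tiling_cover x : exists2 t, P t & within (pos t x).
Proof.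
have [_ _ cov _ _] := hP.
have : (\bigcup_(t in P) region t) x by rewrite cov.
by move=> [t Pt /regionE h]; exists t => //; apply: h; exact: tiling_det.
Qed.

Lemma tiling_inside_uniq t u x : P t -> P u -> inside (pos t x) ->
  inside (pos u x) -> t = u.
Proof.
have [_ _ _ dis _] := hP; move=> Pt Pu it iu.
apply: dis => //; exists x.
by split; apply: inside_interior => //; exact: tiling_det.
Qed.

Lemma tiling_scale : exists2 l : R, 0 < l & forall t, P t -> leg_sqr t = l * l.
Proof.
have [_ [l legl] _ _ _] := hP.
have sq t : P t -> leg_sqr t = l * l.
  move=> Pt; have := legl t Pt; case: t {Pt} => [[A B] C] /= <-.
  by rewrite /dist enorm_sqr !dotE !mxE; ring.
exists l => //; have [t Pt _] := tiling_cover 0.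
have := tiling_robinson Pt; have := sq t Pt; have := legl t Pt.
case: t {Pt} => [[A B] C] /= ll -> [q0 _ _].
rewrite lt_neqAle -ll enorm_ge0 andbT eq_sym; apply/eqP => l0.
by move: q0; rewrite -ll l0 mulr0 ltxx.
Qed.

End TilingFacts.

Section TilingCounts.
Context {R : realType}.
Local Notation phi := (golden R).
Implicit Types (t u v : triangle R) (x y : 'rV[R]_2).
Variables (P : set (triangle R)) (hP : penrose_tiling P).
Variables (l : R) (l0 : 0 < l) (hl : forall t, P t -> leg_sqr t = l * l).

Definition near_tiles x (r : R) : set (triangle R) :=
  [set t | P t /\ exists2 c, c \in corners t & enorm (c - x) <= r].

Lemma apex_corner t : t.1.1 \in corners t.
Proof. by case: t => [[A B] C]; exact: mem_head. Qed.

Lemma tiling_within_dist t x c : P t -> within (pos t x) -> c \in corners t ->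
  enorm (x - c) <= 2 * l.
Proof.
move=> Pt; apply: within_corner_dist => //; [exact: hl|exact: tiling_robinson Pt].
Qed.

(** The tiles are disjoint, have area bounded below and lie in a bounded part of
    the plane. *)
Lemma near_tiles_finite x r : finite_set (near_tiles x r).
Proof.
have [//|inf] := pselect (finite_set (near_tiles x r)).
have [G GE] := bounded_cells (r + 2 * l) x (@ltr01 R).
have gt := @golden_gt R.
pose a : R := unit_area * (l * l) * ((phi + 2) / 5).
have a0 : 0 < a.
  by apply: mulr_gt0; [apply: mulr_gt0; [exact: unit_area_gt0|exact: mulr_gt0]|lra].
have [B BN cB] := infinite_set_fset (Num.bound (#|` G|%:R / a)) inf.
have BP t : t \in B -> P t by move=> tB; have [] := BN t tB.
have : \sum_(t <- B) tile_area t <= 1 * 1 * #|` G|%:R.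
  apply: tiles_in_cells => //.
  - by move=> t /BP; exact: tiling_det.
  - by move=> t u y /BP Pt /BP Pu; exact: (tiling_inside_uniq hP Pt Pu).
  - move=> t y tB iy; have [Pt [c ct cx]] := BN t tB.
    exists (Num.floor (y 0 0 / 1), Num.floor (y 0 1 / 1)); last exact: cell_floor.
    apply: GE (cell_floor y ltr01).
    have := tiling_within_dist Pt (inside_within iy) ct.
    by have := dist_triangle y c x; lra.
have : \sum_(t <- B) tile_area t >= \sum_(t <- B) a.
  rewrite big_seq [leRHS]big_seq; apply: ler_sum => t /BP Pt.
  rewrite tile_areaE ?hl//; last exact: tiling_robinson Pt.
  rewrite /a ler_pM2l; last first.
    by apply: mulr_gt0; [exact: unit_area_gt0|exact: mulr_gt0].
  by rewrite /area_weight; case: ifP => _; lra.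
rewrite big_const_seq count_predT iter_addr_0 !mul1r => h1 h2.
have h3 := le_trans h1 h2.
have h4 : #|` G|%:R / a < #|` B|%:R.
  apply: (@lt_le_trans _ _ (Num.bound (#|` G|%:R / a))%:R); last by rewrite ler_nat.
  by apply: archi_boundP; rewrite divr_ge0// ltW.
by move: h4; rewrite ltr_pdivrMr// mulr_natl ltNge h3.
Qed.

Lemma far_tile (F : {fset triangle R}) : exists2 t, P t & t \notin F.
Proof.
pose M := 1 + 2 * l + \sum_(t <- F) enorm t.1.1.
pose x : 'rV[R]_2 := point_of (M, 0).
have [t Pt tx] := tiling_cover hP x; exists t => //; apply/negP => tF.
have := coord_le_enorm x 0; rewrite mxE /=.
have : enorm (x - t.1.1) <= 2 * l.
  exact: tiling_within_dist Pt tx (apex_corner t).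
have : enorm t.1.1 <= \sum_(t <- F) enorm t.1.1.
  rewrite (bigD1_seq t)//=; last exact: fset_uniq.
  by rewrite lerDl sumr_ge0// => u _; exact: enorm_ge0.
have := enormD (x - t.1.1) t.1.1; rewrite subrK.
by have := ler_norm M; rewrite /M; lra.
Qed.

(** The centroid of [u] is covered by some tile of [P] within [4 * l] of [x],
    which lies in the same supertile and therefore is [u]. *)
Lemma supertile_tile_in_tiling T n u x : robinson (obtuse T) T ->
  (forall t, near_tiles x (4 * l) t -> t \in supertile n T) ->
  u \in supertile n T -> leg_sqr u = l * l -> x \in corners u -> P u.
Proof.
move=> hT sub us lu xu; have [hu _] := robinson_supertile hT us.
have iu := centroid_inside (robinson_det_neq0 hu).
have [t Pt tx] := tiling_cover hP (centroid u).
have xc := within_corner_dist l0 lu hu (inside_within iu) xu.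
suff ts : t \in supertile n T by rewrite (supertile_inside_uniq hT us ts iu tx).
apply: sub; split=> //; exists t.1.1; first exact: apex_corner.
have : enorm (centroid u - t.1.1) <= 2 * l.
  exact: tiling_within_dist Pt tx (apex_corner t).
have := dist_triangle t.1.1 (centroid u) x.
by rewrite (enormB t.1.1 (centroid u)); lra.
Qed.

(** A supertile containing [F], all tiles near its corners, and some tile outside
    [F]; the last one makes [F] a proper part, so that its frontier is not
    empty.  The radius [4 * l] is that of [supertile_tile_in_tiling]. *)
Lemma patch_around (F : {fset triangle R}) t0 : t0 \in F ->
  (forall t, t \in F -> P t) ->
  exists T n, [/\ robinson (obtuse T) T,
    forall t, t \in F -> t \in supertile n T,
    exists2 t, t \in supertile n T & t \notin F,
    forall u, u \in supertile n T -> leg_sqr u = l * l &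
    forall t c, t \in F -> c \in corners t ->
      (forall u, near_tiles c (4 * l) u -> u \in supertile n T)].
Proof.
move=> t0F FP; have [t1 Pt1 t1F] := far_tile F.
pose X := [set` F] `|` [set t1] `|`
  \bigcup_(t in [set` F]) \bigcup_(c in [set` corners t]) near_tiles c (4 * l).
have fX : finite_set X.
  rewrite /X finite_setU; split.
    by rewrite finite_setU; split; [exact: finite_fset|exact: finite_set1].
  apply: bigcup_finite; first exact: finite_fset.
  move=> t _; apply: bigcup_finite; first exact: finite_seq.
  by move=> c _; exact: near_tiles_finite.
have XP : X `<=` P.
  move=> t [[/= /FP//|->//]|[u _ [c _ []]]//].
have [T [n [hT Xs]]] := finite_patch hP fX XP.
have Fs t : t \in F -> t \in supertile n T by move=> tF; apply: Xs; left; left.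
exists T, n; split=> //.
- by exists t1 => //; apply: Xs; left; right.
- move=> u us; have [_ ->] := robinson_supertile hT us.
  by have [_ <-] := robinson_supertile hT (Fs _ t0F); rewrite hl//; exact: FP.
- by move=> t c tF ct u nu; apply: Xs; right; exists t => //; exists c.
Qed.

(** [F'] adds to [F] its frontier, whose weight absorbs the discrepancy of [F]
    in both directions. *)
Lemma tiling_weight_count (F : {fset triangle R}) :
  (forall t, t \in F -> P t) -> exists F' : {fset triangle R},
  [/\ forall t, t \in F' -> P t,
      forall t, t \in F' -> exists2 u, u \in F & touch t u,
      #|` F|%:R <= \sum_(t <- F') area_weight t &
      \sum_(t <- F) area_weight t <= #|` F'|%:R].
Proof.
move=> FP; have [->|[t0 t0F]] := fset_0Vmem F.
  by exists fset0; split=> // [|]; rewrite big_seq_fset0 cardfs0.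
have [T [n [hT Fs [t1 t1s t1F] ls nears]]] := patch_around t0F FP.
set s := supertile n T in Fs t1s ls nears.
pose f := mem F.
pose Bs := [seq u <- s | ~~ f u && has (fun v => f v && touch u v) s].
have us := supertile_uniq n hT.
have mx : mixed f s.
  by apply/andP; split; apply/hasP; [exists t0; [exact: Fs|]|exists t1].
have [lo hi] := supertile_frontier hT mx.
have uB : uniq Bs by rewrite filter_uniq.
have BP u : u \in Bs -> P u.
  rewrite mem_filter => /andP[/andP[_ /hasP[v vs /andP[vF /hasP[x xv xu]]]] u_s].
  by apply: (supertile_tile_in_tiling hT (nears v x vF xv) u_s (ls _ u_s) xu).
have gt := @golden_gt R.
have ge u : (phi + 2) / 5 <= area_weight u.
  by rewrite /area_weight; case: ifP => _; lra.
have sumF (h : triangle R -> R) : \sum_(u <- s | f u) h u = \sum_(u <- F) h u.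
  rewrite -big_filter; apply: perm_big; apply: uniq_perm.
  - by rewrite filter_uniq.
  - exact: fset_uniq.
  - by move=> u; rewrite mem_filter; apply/andP/idP => [[]//|uF]; split=> //; exact: Fs.
have sizeB : (frontier f s)%:R = \sum_(u <- Bs) 1 :> R.
  by rewrite big_const_seq count_predT iter_addr_0 size_filter.
exists (seq_fset tt (enum_fset F ++ Bs)).
have disj : uniq (enum_fset F ++ Bs).
  rewrite cat_uniq fset_uniq uB andbT; apply/hasPn => u.
  by rewrite mem_filter => /andP[/andP[]].
have pF' : perm_eq (seq_fset tt (enum_fset F ++ Bs)) (enum_fset F ++ Bs).
  by apply: uniq_perm => // u; rewrite seq_fsetE.
have sumF' (h : triangle R -> R) :
    \sum_(u <- seq_fset tt (enum_fset F ++ Bs)) h u = \sum_(u <- F) h u + \sum_(u <- Bs) h u.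
  by rewrite (perm_big _ pF') big_cat.
have card (A : {fset triangle R}) : #|` A|%:R = \sum_(u <- A) 1 :> R.
  by rewrite big_const_seq count_predT iter_addr_0.
have exc : \sum_(u <- s | f u) excess u = #|` F|%:R - \sum_(u <- F) area_weight u.
  by rewrite sumF /excess sumrB card.
rewrite sizeB exc in lo hi.
split.
- move=> t; rewrite seq_fsetE mem_cat => /orP[/FP//|]; exact: BP.
- move=> t; rewrite seq_fsetE mem_cat => /orP[tF|].
    exists t => //; apply/hasP; exists t.1.1; exact: apex_corner.
  rewrite mem_filter => /andP[/andP[_ /hasP[v _ /andP[vF tv]]] _].
  by exists v.
- rewrite sumF'.
  have : (phi + 2) / 5 * \sum_(u <- Bs) 1 <= \sum_(u <- Bs) area_weight u.
    by rewrite mulr_sumr; apply: ler_sum => u _; rewrite mulr1; exact: ge.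
  by move: hi; lra.
- by rewrite card sumF' -card; move: lo; lra.
Qed.

End TilingCounts.

Lemma leq_sum_support (I : eqType) (s r : seq I) (w : I -> nat) :
  uniq s -> uniq r -> (forall i, i \in s -> i \notin r -> w i = 0%N) ->
  (\sum_(i <- s) w i <= \sum_(i <- r) w i)%N.
Proof.
move=> us ur w0; rewrite (bigID (mem r)) /=.
rewrite [X in (_ + X)%N]big_seq_cond [X in (_ + X)%N]big1 ?addn0; last first.
  by move=> i /andP[]; exact: w0.
rewrite -big_filter (perm_big [seq i <- r | i \in s]); last first.
  by apply: uniq_perm; rewrite ?filter_uniq// => i; rewrite !mem_filter andbC.
by rewrite big_filter [leqRHS](bigID (mem s)) /= leq_addr.
Qed.

Section TilingVertices.
Context {R : realType}.
Local Notation phi := (golden R).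
Implicit Types (t u v : triangle R) (x y : 'rV[R]_2).
Variables (P : set (triangle R)) (hP : penrose_tiling P).
Variables (l : R) (l0 : 0 < l) (hl : forall t, P t -> leg_sqr t = l * l).

Lemma verticesE x : vertices P x <-> exists2 t, P t & x \in corners t.
Proof.
split=> -[t Pt]; case: t Pt => [[A B] C] Pt h; exists (A, B, C) => //.
  by case: h => ->; rewrite !inE eqxx ?orbT.
by move: h; rewrite !inE => /or3P[] /eqP->; [constructor 1|constructor 2|constructor 3].
Qed.

(** A vanishing coordinate would become negative by moving the point a little
    parallel to a side. *)
Lemma disc_inside T x : tri_det T != 0 ->
  (forall y, enorm (y - x) <= l -> within (pos T y)) -> inside (pos T x).
Proof.
case: T => [[A B] C] d0 disc; case E: (coords (A, B, C) x) => [[a b] c].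
have s1 := coords_sum E; have xE := coords_comb d0 E.
pose m := enorm (B - A) + enorm (C - A) + 1.
have m1 : 0 < m by have := enorm_ge0 (B - A); have := enorm_ge0 (C - A); rewrite /m; lra.
pose e := l / m; have e0 : 0 < e by apply: divr_gt0.
have move_in (w : 'rV[R]_2) (a' b' c' : R) : enorm w <= m -> a' + b' + c' = 1 ->
    x + e *: w = a' *: A + b' *: B + c' *: C -> [&& 0 <= a', 0 <= b' & 0 <= c'].
  move=> wm s1' yE; have : within (pos (A, B, C) (x + e *: w)).
    apply: disc; rewrite addrC addKr enormZ gtr0_norm// /e mulrAC ler_pdivrMr//.
    by rewrite ler_pM2l.
  by rewrite /pos (coords_uniq d0 s1' yE).
have nB := enorm_ge0 (B - A); have nC := enorm_ge0 (C - A).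
have /and3P[a1 _ _] := @move_in (B - A) (a - e) (b + e) c
  ltac:(rewrite /m; lra) ltac:(lra) ltac:(rewrite xE; apply: row2P; rewrite !mxE; ring).
have /and3P[_ b1 _] := @move_in (A - B) (a + e) (b - e) c
  ltac:(rewrite enormB /m; lra) ltac:(lra) ltac:(rewrite xE; apply: row2P; rewrite !mxE; ring).
have /and3P[_ _ c1] := @move_in (A - C) (a + e) b (c - e)
  ltac:(rewrite enormB /m; lra) ltac:(lra) ltac:(rewrite xE; apply: row2P; rewrite !mxE; ring).
by rewrite /pos E /=; apply/and3P; split; lra.
Qed.

Definition star x : {fset triangle R} := fset_set [set t | P t /\ x \in corners t].

Lemma mem_star t x : (t \in star x) <-> P t /\ x \in corners t.
Proof.
rewrite /star in_fset_set; first by rewrite in_setE.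
apply: sub_finite_set (near_tiles_finite hP l0 hl x 0) => u [Pu xu]; split=> //.
exists x => //; rewrite subrr -(scale0r 0) enormZ normr0 mul0r; exact: lexx.
Qed.

(** The tiles of [P] around [x] are those of a supertile containing a disc
    around [x], in which the angles add up to a full turn. *)
Lemma star_sum x : vertices P x -> (\sum_(t <- star x) angle_weight t x = 10)%N.
Proof.
move=> /verticesE[t0 Pt0 xt0].
have [|t|T [n [hT Fs _ ls nears]]] := patch_around hP l0 hl (F := [fset t0]%fset) (t0 := t0).
- by rewrite in_fset1.
- by rewrite in_fset1 => /eqP->.
have nx := nears t0 x ltac:(by rewrite in_fset1) xt0.
have ix : inside (pos T x).
  apply: disc_inside; first exact: robinson_det_neq0 hT.
  move=> y yx; have [t Pt ty] := tiling_cover hP y.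
  have ts : t \in supertile n T.
    apply: nx; split=> //; exists t.1.1; first exact: apex_corner.
    have := tiling_within_dist hP l0 hl Pt ty (apex_corner t).
    by have := dist_triangle t.1.1 y x; rewrite (enormB t.1.1 y); have := l0; lra.
  apply: (@descendants_within _ n _ (pos t y)) => //.
  by rewrite -pos_supertile//; apply: map_f.
have t0s : t0 \in supertile n T by apply: Fs; rewrite in_fset1.
rewrite -(supertile_angle_sum hT ix t0s xt0).
have w0 u : tri_det u != 0 -> x \notin corners u -> angle_weight u x = 0%N.
  by move=> d0; rewrite -angle_weight_gt0// lt0n negbK => /eqP.
apply/eqP; rewrite eqn_leq; apply/andP; split.
- apply: leq_sum_support; [exact: fset_uniq|exact: supertile_uniq|].
  move=> u /mem_star[Pu xu] /negP[]; apply: nx; split=> //; exists x => //.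
  by rewrite subrr -(scale0r 0) enormZ normr0 mul0r mulr_ge0// ltW.
- apply: leq_sum_support; [exact: supertile_uniq|exact: fset_uniq|].
  move=> u us /negP nu; have [hu _] := robinson_supertile hT us.
  apply: w0; first exact: robinson_det_neq0 hu.
  apply/negP => xu; apply: nu; apply/mem_star; split=> //.
  exact: (supertile_tile_in_tiling hP l0 hl hT nx us (ls _ us) xu).
Qed.

(** Double counting of angles: a vertex receives ten tenths of a turn, a tile
    gives five. *)
Lemma vertices_le_tiles (A : {fset 'rV[R]_2}) : (forall x, x \in A -> vertices P x) ->
  exists F : {fset triangle R}, [/\ forall t, t \in F -> P t,
    forall t, t \in F -> exists2 x, x \in A & x \in corners t &
    (2 * #|` A| <= #|` F|)%N].
Proof.
move=> AV; pose F := (\bigcup_(x <- A) star x)%fset.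
have FP t : t \in F -> exists2 x, x \in A & t \in star x.
  by move=> /bigfcupP[x]; rewrite andbT => xA tx; exists x.
exists F; split=> [t /FP[x _ /mem_star[]]//|t /FP[x xA /mem_star[_ xt]]|].
  by exists x.
suff : (10 * #|` A| <= 5 * #|` F|)%N by lia.
have -> : (10 * #|` A| = \sum_(x <- A) 10)%N.
  by rewrite big_const_seq count_predT iter_addn_0.
have -> : (5 * #|` F| = \sum_(t <- F) 5)%N.
  by rewrite big_const_seq count_predT iter_addn_0.
apply: (@leq_trans (\sum_(x <- A) \sum_(t <- F) angle_weight t x)).
  rewrite big_seq [leqRHS]big_seq; apply: leq_sum => x xA.
  rewrite -(star_sum (AV x xA)); apply: leq_sum_support; try exact: fset_uniq.
  move=> t tx /negP[]; apply/bigfcupP; exists x; by rewrite ?xA.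
rewrite exchange_big /= big_seq [leqRHS]big_seq; apply: leq_sum => t /FP[x _ /mem_star[Pt _]].
have d0 := tiling_det hP Pt.
rewrite -(sum_angle_weight d0); apply: leq_sum_support.
- exact: fset_uniq.
- exact: corners_uniq.
- by move=> y _; rewrite -angle_weight_gt0// lt0n negbK => /eqP.
Qed.

(** The same double count, over all corners of the tiles of [F]. *)
Lemma tiles_le_vertices (F : {fset triangle R}) : (forall t, t \in F -> P t) ->
  exists A : {fset 'rV[R]_2},
    (forall x, x \in A -> exists2 t, t \in F & x \in corners t) /\
    (#|` F| <= 2 * #|` A|)%N.
Proof.
move=> FP; pose A := (\bigcup_(t <- F) seq_fset tt (corners t))%fset.
have AF x : x \in A -> exists2 t, t \in F & x \in corners t.
  by move=> /bigfcupP[t]; rewrite andbT seq_fsetE => tF xt; exists t.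
exists A; split=> //.
suff : (5 * #|` F| <= 10 * #|` A|)%N by lia.
have -> : (10 * #|` A| = \sum_(x <- A) 10)%N.
  by rewrite big_const_seq count_predT iter_addn_0.
have -> : (5 * #|` F| = \sum_(t <- F) 5)%N.
  by rewrite big_const_seq count_predT iter_addn_0.
apply: (@leq_trans (\sum_(t <- F) \sum_(x <- A) angle_weight t x)).
  rewrite big_seq [leqRHS]big_seq; apply: leq_sum => t tF.
  have d0 := tiling_det hP (FP _ tF).
  rewrite -(sum_angle_weight d0); apply: leq_sum_support.
  - exact: corners_uniq.
  - exact: fset_uniq.
  - move=> x xt /negP[]; apply/bigfcupP; exists t; by rewrite ?tF// seq_fsetE.
rewrite exchange_big /= big_seq [leqRHS]big_seq; apply: leq_sum => x /AF[t tF xt].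
have Vx : vertices P x by apply/verticesE; exists t => //; exact: FP.
rewrite -(star_sum Vx); apply: leq_sum_support; try exact: fset_uniq.
move=> u uF /negP nu; apply/eqP; rewrite -leqn0 leqNgt angle_weight_gt0.
  by apply/negP => xu; apply: nu; apply/mem_star; split=> //; exact: FP.
exact: tiling_det hP _ (FP _ uF).
Qed.

End TilingVertices.

(** * The square lattice *)
Section Lattice.
Context {R : realType}.
Implicit Types (h : R) (c : int * int) (x y : 'rV[R]_2).

Definition grid_point h c : 'rV[R]_2 := point_of (h * c.1%:~R, h * c.2%:~R).

Definition grid h : set 'rV[R]_2 := range (grid_point h).

Lemma grid_pointE h c : (grid_point h c 0 0 = h * c.1%:~R) *
  (grid_point h c 0 1 = h * c.2%:~R).
Proof. by rewrite !mxE. Qed.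

Lemma grid_point_inj h : 0 < h -> injective (grid_point h).
Proof.
move=> h0 [a b] [a' b'] e; have hn : h != 0 by exact: lt0r_neq0.
have := congr1 (fun x : 'rV[R]_2 => x 0 0) e; have := congr1 (fun x : 'rV[R]_2 => x 0 1) e.
by rewrite /= !grid_pointE /= => /(mulfI hn) /intr_inj -> /(mulfI hn) /intr_inj ->.
Qed.

Lemma cell_grid_point h c : 0 < h -> cell h c (planar (grid_point h c)).
Proof.
by move=> h0; split; rewrite /planar /= in_itv /= grid_pointE lexx ltr_pM2l// ltr_int ltzD1 /=.
Qed.

Lemma cell_dist h c x : 0 < h -> cell h c (planar x) ->
  enorm (x - grid_point h c) <= 2 * h.
Proof.
move=> h0 [/=]; rewrite !in_itv /= !intrD !mulrDr mulr1 => /andP[a1 a2] /andP[b1 b2].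
have h2 : 0 <= 2 * h by lra.
rewrite -(ger0_norm h2) -(ger0_norm (enorm_ge0 _)) -ler_sqr ?nnegrE//.
rewrite !real_normK ?num_real// [leLHS]expr2 enorm_sqr dotE !mxE /=.
have p0 : 0 <= x 0 0 - h * c.1%:~R <= h by apply/andP; split; lra.
have p1 : 0 <= x 0 1 - h * c.2%:~R <= h by apply/andP; split; lra.
by move: p0 p1; set p := x 0 0 - _; set q := x 0 1 - _ => /andP[? ?] /andP[? ?]; nra.
Qed.

(** The coefficients are the cross product of the two rows, or, when the rows
    are parallel, a relation between the first two columns. *)
Lemma int_plane_dependence (a0 a1 a2 b0 b1 b2 : int) : exists c0 c1 c2 : int,
  [/\ ~~ [&& c0 == 0, c1 == 0 & c2 == 0], a0 * c0 + a1 * c1 + a2 * c2 = 0 &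
      b0 * c0 + b1 * c1 + b2 * c2 = 0].
Proof.
have [/and3P[/eqP z0 /eqP z1 /eqP z2]|nz] :=
  boolP [&& a1 * b2 - a2 * b1 == 0, a2 * b0 - a0 * b2 == 0 & a0 * b1 - a1 * b0 == 0];
  last first.
  by do 3!eexists; split; [exact: nz|ring|ring].
have [/andP[/eqP e0 /eqP e1]|nz] := boolP ((a0 == 0) && (a1 == 0)); last first.
  exists a1, (- a0), 0; split; [|ring|lra].
  by rewrite oppr_eq0 eqxx andbT andbC.
have [/andP[/eqP f0 /eqP f1]|nz] := boolP ((b0 == 0) && (b1 == 0)); last first.
  exists b1, (- b0), 0; split; [|by rewrite e0 e1; ring|ring].
  by rewrite oppr_eq0 eqxx andbT andbC.
by exists 1, 0, 0; split; [|rewrite e0; ring|rewrite f0; ring].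
Qed.

Lemma intmul_coord x (k : int) (j : 'I_2) : (x *~ k) 0 j = k%:~R * x 0 j.
Proof. by rewrite -scaler_int mxE. Qed.

Lemma grid_lattice h : 0 < h -> lattice (grid h).
Proof.
move=> h0; split.
- split; first by rewrite /= in_setE; exists (0, 0) => //; apply: row2P; rewrite grid_pointE mxE mulr0.
  move=> x y; rewrite /= !in_setE => -[c _ <-] [d _ <-].
  by exists (c.1 - d.1, c.2 - d.2) => //; apply: row2P;
    rewrite [in RHS]mxE [in X in _ = _ + X]mxE !grid_pointE /= intrB mulrBr.
- move=> _ [c _ <-]; split; first by rewrite in_setE; exists c.
  exists (ball (grid_point h c) h); first exact: nbhsx_ballx.
  apply/seteqP; split=> [x [bx [d _ dx]]|x ->]; last by split; [exact: ballxx|exists c].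
  rewrite -{}dx in bx *; congr grid_point.
  have coord (a b : int) : `|h * a%:~R - h * b%:~R| < h -> b = a.
    rewrite -mulrBr -intrB normrM (gtr0_norm h0) -ltr_pdivlMl// mulVf ?gt_eqF//.
    by rewrite -intr_norm ltrz1; lia.
  have [_ bxx] := bx; have := bxx 0 0; have := bxx 0 1.
  rewrite /ball /= !grid_pointE => /coord b1 /coord b0.
  by rewrite (surjective_pairing d) b0 b1 -surjective_pairing.
- split.
    exists (fun i : 'I_2 => grid_point h (if i == 0 then (1, 0) else (0, 1))).
      by move=> i; exists (if i == 0 then (1, 0) else (0, 1)).
    move=> c; rewrite big_ord_recl big_ord1 /= => e.
    have e0 := congr1 (fun x : 'rV[R]_2 => x 0 0) e.
    have e1 := congr1 (fun x : 'rV[R]_2 => x 0 1) e.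
    rewrite /= !mxE !intmul_coord !grid_pointE /= !mulr0 !mulr1 ?addr0 ?add0r in e0 e1.
    have z k : k%:~R * h = 0 -> k = 0 :> int.
      by move=> /eqP; rewrite mulf_eq0 (gt_eqF h0) orbF intr_eq0 => /eqP.
    by move=> i; case: (unliftP ord0 i) => [j ->|->];
      [rewrite (ord1 j); exact: z e1|exact: z e0].
  move=> m s sL zs; rewrite leqNgt; apply/negP => m3.
  have /boolp.choice[v vE] : forall i, exists c, s i = grid_point h c.
    by move=> i; have [c _ <-] := sL i; exists c.
  pose i0 := Ordinal (ltn_trans (isT : 0 < 2)%N m3).
  pose i1 := Ordinal (ltn_trans (isT : 1 < 2)%N m3).
  pose i2 := Ordinal m3.
  have [c0 [c1 [c2 [nz ea eb]]]] := int_plane_dependence (v i0).1 (v i1).1 (v i2).1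
    (v i0).2 (v i1).2 (v i2).2.
  pose c i := if i == i0 then c0 else if i == i1 then c1 else if i == i2 then c2 else 0.
  have : \sum_(i < m) s i *~ c i = 0.
    rewrite (bigD1 i0)//= (bigD1 i1)//= (bigD1 i2)//= big1 ?addr0; last first.
      by move=> i /andP[/andP[/negbTE n0 /negbTE n1] /negbTE n2]; rewrite /c n0 n1 n2 mulr0z.
    rewrite /c /= !vE.
    apply: row2P; rewrite !mxE !intmul_coord !grid_pointE.
      by transitivity (h * ((v i0).1 * c0 + (v i1).1 * c1 + (v i2).1 * c2)%:~R);
        [rewrite !intrD !intrM; ring|rewrite ea mulr0].
    by transitivity (h * ((v i0).2 * c0 + (v i1).2 * c1 + (v i2).2 * c2)%:~R);
      [rewrite !intrD !intrM; ring|rewrite eb mulr0].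
  move=> /zs cz; case/negP: nz; apply/and3P; split; apply/eqP.
  - exact: (cz i0).
  - exact: (cz i1).
  - exact: (cz i2).
Qed.

End Lattice.

(** * Vertices against lattice points *)
Section Comparison.
Context {R : realType}.
Implicit Types (t u v : triangle R) (x y : 'rV[R]_2) (c : int * int).
Variables (P : set (triangle R)) (hP : penrose_tiling P).
Variables (l : R) (l0 : 0 < l) (hl : forall t, P t -> leg_sqr t = l * l).
(* The area of a cell equals that of two units of weight, because a vertex
   accounts for two tiles. *)
Variables (h : R) (h0 : 0 < h) (hh : h * h = 2 * (unit_area * (l * l))).

(* A lattice point is within [2 * h] of its cell, a point of a tile within
   [2 * l] of its corners; at most three tiles are crossed. *)
Let reach : R := 6 * l + 2 * h.

Definition near_grid x : {fset int * int} :=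
  fset_set [set c | enorm (grid_point h c - x) <= reach].

Lemma mem_near_grid x c :
  (c \in near_grid x) <-> enorm (grid_point h c - x) <= reach.
Proof.
rewrite /near_grid in_fset_set; first by rewrite in_setE.
have [G GE] := bounded_cells reach x h0.
apply: sub_finite_set (finite_fset G) => d /= dx.
exact: GE dx (cell_grid_point d h0).
Qed.

Definition near_vertices c : {fset 'rV[R]_2} :=
  fset_set [set x | vertices P x /\ enorm (grid_point h c - x) <= reach].

Lemma mem_near_vertices x c : (x \in near_vertices c) <->
  vertices P x /\ enorm (grid_point h c - x) <= reach.
Proof.
rewrite /near_vertices in_fset_set; first by rewrite in_setE.
apply: (@sub_finite_set _ _
  (\bigcup_(t in near_tiles P (grid_point h c) reach) [set` corners t])).
  move=> y [/verticesE[t Pt ty] yc]; exists t => //; split=> //.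
  by exists y => //; rewrite enormB.
apply: bigcup_finite; first exact: (near_tiles_finite hP l0 hl (grid_point h c) reach).
by move=> t _; exact: finite_seq.
Qed.

Let area_sum (F : {fset triangle R}) : (forall t, t \in F -> P t) ->
  \sum_(t <- F) tile_area t = unit_area * (l * l) * \sum_(t <- F) area_weight t.
Proof.
move=> FP; rewrite mulr_sumr big_seq [RHS]big_seq; apply: eq_bigr => t /FP Pt.
by rewrite tile_areaE ?hl//; exact: tiling_robinson hP _ Pt.
Qed.

Let unit0 : 0 < unit_area * (l * l) :> R.
Proof. by apply: mulr_gt0; [exact: unit_area_gt0|exact: mulr_gt0]. Qed.

Let touch_dist t u x y : P t -> P u -> touch t u -> x \in corners t ->
  y \in corners u -> enorm (x - y) <= 4 * l.
Proof.
move=> Pt Pu /hasP[z zu zt] xt yu.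
have := tiling_within_dist hP l0 hl Pt (within_corner (tiling_det hP Pt) xt) zt.
have := tiling_within_dist hP l0 hl Pu (within_corner (tiling_det hP Pu) zu) yu.
by have := dist_triangle x z y; lra.
Qed.

(** Vertices, tiles touching them, tiles touching these, cells meeting them: at
    each step the count does not decrease after normalisation. *)
Lemma hall_vertices : hall (vertices P) near_grid.
Proof.
move=> A AV.
have [|F [FP FA cF]] := vertices_le_tiles hP l0 hl (A := A).
  by move=> x /AV; rewrite in_setE.
have [F' [F'P F'F c1 _]] := tiling_weight_count hP l0 hl FP.
have : \sum_(t <- F') tile_area t <= h * h * #|` neighbours near_grid A|%:R.
  apply: tiles_in_cells => //.
  - by move=> t /F'P; exact: tiling_det hP _.
  - by move=> t u y /F'P Pt /F'P Pu; exact: (tiling_inside_uniq hP Pt Pu).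
  - move=> t y tF iy; have cy := cell_floor y h0.
    exists (Num.floor (y 0 0 / h), Num.floor (y 0 1 / h)); last exact: cy.
    have [u uF [z zu zt]] : exists2 u, u \in F & exists2 z, z \in corners u & z \in corners t.
      by have [u uF /hasP[z zu zt]] := F'F t tF; exists u => //; exists z.
    have [x xA xu] := FA u uF.
    apply/neighboursP; exists x => //; apply/mem_near_grid.
    have := tiling_within_dist hP l0 hl (F'P _ tF) (inside_within iy) zt.
    have := tiling_within_dist hP l0 hl (FP _ uF) (within_corner (tiling_det hP (FP _ uF)) zu) xu.
    have := cell_dist h0 cy; rewrite enormB.
    have := dist_triangle (grid_point h (Num.floor (y 0 0 / h), Num.floor (y 0 1 / h))) y x.
    have := dist_triangle y z x.
    by rewrite /reach; have := l0; lra.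
rewrite area_sum// hh; move: unit0; set k := unit_area * _ => k0.
rewrite -mulrA mulrCA (ler_pM2l k0) => c2.
have {}cF : 2 * #|` A|%:R <= #|` F|%:R :> R by rewrite -natrM ler_nat.
by rewrite -(@ler_nat R); lra.
Qed.

(** The chain of [hall_vertices] read in the opposite direction. *)
Lemma hall_grid : hall [set: int * int] near_vertices.
Proof.
move=> G _.
pose F := (\bigcup_(c <- G) fset_set (near_tiles P (grid_point h c) (2 * l + 2 * h)))%fset.
have FE t : t \in F <-> exists2 c, c \in G & near_tiles P (grid_point h c) (2 * l + 2 * h) t.
  have fin c := near_tiles_finite hP l0 hl (grid_point h c) (2 * l + 2 * h).
  split=> [/bigfcupP[c]|[c cG nt]].
    by rewrite andbT in_fset_set// in_setE => cG nt; exists c.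
  by apply/bigfcupP; exists c; rewrite ?cG// in_fset_set// in_setE.
have FP t : t \in F -> P t by move=> /FE[c _ []].
have [F' [F'P F'F _ c1]] := tiling_weight_count hP l0 hl FP.
have [A [AF' cA]] := tiles_le_vertices hP l0 hl F'P.
have : h * h * #|` G|%:R <= \sum_(t <- F) tile_area t.
  apply: cells_in_tiles => //.
  - by move=> t /FP; exact: tiling_det hP _.
  - move=> c y cG cy; have [t Pt ty] := tiling_cover hP y; exists t => //.
    apply/FE; exists c => //; split=> //; exists t.1.1; first exact: apex_corner.
    have := tiling_within_dist hP l0 hl Pt ty (apex_corner t).
    have := cell_dist h0 cy; have := dist_triangle t.1.1 y (grid_point h c).
    by rewrite (enormB t.1.1 y); lra.
rewrite area_sum// hh; move: unit0; set k := unit_area * _ => k0.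
rewrite -mulrA mulrCA (ler_pM2l k0) => c2.
have {}cA : #|` F'|%:R <= 2 * #|` A|%:R :> R by rewrite -natrM ler_nat.
apply: (@leq_trans #|` A|); first by rewrite -(@ler_nat R); lra.
apply: fsubset_leq_card; apply/fsubsetP => x xA.
have [t tF' xt] := AF' x xA; have [u uF tu] := F'F t tF'.
have /FE[c cG [Pu [z zu zc]]] := uF.
apply/neighboursP; exists c => //; apply/mem_near_vertices; split.
  by apply/verticesE; exists t => //; exact: F'P.
have := touch_dist (F'P _ tF') Pu tu xt zu.
have := dist_triangle x z (grid_point h c); rewrite enormB.
by rewrite /reach; lra.
Qed.

End Comparison.

Theorem theorem1p2 (R : realType) (P : set (triangle R))
    (hP : penrose_tiling P) :
  exists (L : set 'rV[R]_2) (f : 'rV[R]_2 -> 'rV[R]_2) (C : R),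
    [/\ lattice L,
        set_bij (vertices P) L f &
        forall y, vertices P y -> enorm (f y - y) <= C].
Proof.
have [l l0 hl] := tiling_scale hP.
have u0 : 0 < 2 * (unit_area * (l * l)) :> R.
  by rewrite mulr_gt0// mulr_gt0 ?unit_area_gt0// mulr_gt0.
pose h := Num.sqrt (2 * (unit_area * (l * l))) : R.
have h0 : 0 < h by rewrite sqrtr_gt0.
have hh : h * h = 2 * (unit_area * (l * l)) by rewrite -expr2 sqr_sqrtr// ltW.
have [f [fN fI]] := hall_matching (0, 0) (hall_vertices hP l0 hl h0 hh).
have [g [gN gI]] := hall_matching 0 (hall_grid hP l0 hl h0 hh).
have [k [[kfun kinj ksurj] kE]] := @bernstein_relation _ _ (vertices P) [set: int * int]
  (fun x c => enorm (grid_point h c - x) <= 6 * l + 2 * h) f g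
  ltac:(by move=> x /fN /(mem_near_grid _ h0))
  ltac:(by move=> x x' /set_mem Vx /set_mem Vx'; exact: fI)
  ltac:(by move=> c _; apply/(mem_near_vertices hP l0 hl); exact: gN)
  ltac:(by move=> c c' _ _; exact: gI).
exists (grid h), (grid_point h \o k), (6 * l + 2 * h); split=> //.
- exact: grid_lattice.
- split=> [x Vx|x x' Vx Vx' /(grid_point_inj h0)|_ [c _ <-]].
  + by exists (k x).
  + exact: kinj.
  + by have [x Vx <-] := ksurj c I; exists x.
Qed.
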